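(* Let $(\mathcal{E},\mathcal{D}(\mathcal{E}))$ be a regular, irreducible, transient Dirichlet form on $L^2(E;m)$, and let $\mu$ be a positive smooth Radon measure on $E$ such that the form $\mathcal{E}^\mu(u,v)=\mathcal{E}(u,v)-\int_Euv\,d\mu$ on $\mathcal{D}(\mathcal{E})\cap C_0(E)$ is positive semi-definite and closable in $L^2(E;m)$, with closure $(\mathcal{E}^\mu,\mathcal{D}(\mathcal{E}^\mu))$. Suppose $(\mathcal{E}^\mu,\mathcal{D}(\mathcal{E}^\mu))$ is subcritical and let $g\in L^1(E;m)$ be a bounded function, strictly positive $m$-a.e., such that $\int_E|u|g\,dm\le\sqrt{\mathcal{E}^\mu(u)}$ for all $u\in\mathcal{D}_e(\mathcal{E}^\mu)$. Then $G^\mu g=\int_0^\infty T^\mu_tg\,dt$ belongs to $\mathcal{D}_e(\mathcal{E}^\mu)$.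
   Context: $E$ is a locally compact separable metric space, $m$ a positive Radon measure on $E$ with full topological support, $C_0(E)$ the continuous functions with compact support; $a(u)=a(u,u)$. Irreducible: if a measurable $A\subset E$ satisfies $T_t(1_Af)=1_AT_tf$ $m$-a.e. for all $f\in L^2(E;m)$, $t>0$ ($T_t$ the semigroup of $\mathcal{E}$), then $m(A)=0$ or $m(A^c)=0$. Transient: there is a bounded $g_0\in L^1(E;m)$, $g_0>0$ $m$-a.e., with $\int_E|u|g_0\,dm\le\sqrt{\mathcal{E}(u)}$ for $u\in\mathcal{D}(\mathcal{E})$. A positive Borel measure is smooth if it charges no set of zero capacity and there are increasing closed sets $F_n$ with $\mu(F_n)<\infty$ and $\lim_n\mathrm{Cap}(K\setminus F_n)=0$ for every compact $K$ (Cap is the 1-capacity of $\mathcal{E}$). $\mathcal{D}_e(\mathcal{E}^\mu)$ (extended Schrödinger space) is the set of $m$-measurable $u$ with $|u|<\infty$ $m$-a.e. for which there is an $\mathcal{E}^\mu$-Cauchy sequence $u_n\in\mathcal{D}(\mathcal{E}^\mu)$ with $u_n\to u$ $m$-a.e.; $\mathcal{E}^\mu(u)=\lim_n\mathcal{E}^\mu(u_n)$. Subcritical means that a function $g$ as in the claim exists. $\{T^\mu_t\}$ is the $L^2(E;m)$-semigroup of $(\mathcal{E}^\mu,\mathcal{D}(\mathcal{E}^\mu))$, which is positivity preserving. *)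

(* Defs.v *)
From HB Require Import structures.
From mathcomp Require Import all_boot all_order all_algebra.
From mathcomp Require Import all_classical all_reals all_analysis measurable_realfun.

Set Implicit Arguments.
Unset Strict Implicit.
Unset Printing Implicit Defensive.
Import Order.TTheory GRing.Theory Num.Theory.
Import numFieldNormedType.Exports.

Local Open Scope classical_set_scope.
Local Open Scope ring_scope.

HB.mixin Record isBorel d T & Topological T & Measurable d T := {
  borelE : @measurable d T = <<s @open T >>
}.

#[short(type="borelMetricType")]
HB.structure Definition BorelMetric (R : numDomainType) d :=
  { T of Metric R T & Measurable d T & isBorel d T }.

Definition separable (T : topologicalType) :=
  exists2 D : set T, countable D & dense D.

Section measures.
Context {R : realType} {d : measure_display} {E : borelMetricType R d}.
Implicit Types mu : {measure set E -> \bar R}.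

(* On a locally compact space, finiteness on compact sets is the same as local
   finiteness. *)
Definition radon mu :=
  (forall K : set E, compact K -> (mu K < +oo)%E) /\
  (forall A : set E, measurable A ->
     mu A = ereal_sup [set mu K | K in [set K | compact K /\ K `<=` A]]).

Definition full_support mu :=
  forall O : set E, open O -> O !=set0 -> (0 < mu O)%E.

(* Compact support, not merely vanishing at infinity. *)
Definition C0 : set (E -> R) :=
  [set u | continuous u /\ compact (closure [set x | u x != 0])].

End measures.

(* Elements of L^2(E; m) are represented by square integrable Borel functions;
   identifications modulo m-null sets are made explicit. *)

Record L2form (E : Type) (R : Type) := L2Form {
  fdom : set (E -> R) ;
  fval : (E -> R) -> (E -> R) -> R }.

Section forms.
Context {R : realType} {d : measure_display} {E : borelMetricType R d}.
Variable m : {measure set E -> \bar R}.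
Implicit Types (a : L2form E R) (u v f g h : E -> R) (us vs : nat -> E -> R)
  (T : R -> (E -> R) -> (E -> R)).

Definition L2 : set (E -> R) := [set f | f \in Lfun m 2%:E].

Definition inner f g : R := \int[m]_x (f x * g x).

Definition L2norm f : \bar R := 'N[m]_2%:E[EFin \o f]%E.

Definition L2_cvg us u :=
  L2norm (us n \- u) @[n --> \oo] --> 0%E.

Definition energy a u : R := fval a u u.

Definition energy1 a u : R := energy a u + inner u u.

Definition form_cauchy a us :=
  (forall n, fdom a (us n)) /\
  forall e : R, 0 < e -> exists N, forall n k, (N <= n)%N -> (N <= k)%N ->
    energy a (us n \- us k) < e.

Record dirichlet_form a : Prop := {
  df_L2 : fdom a `<=` L2 ;
  df_ae : forall u v, fdom a u -> L2 v -> u = v %[ae m] -> fdom a v ;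
  df_val_ae : forall u v h, fdom a u -> fdom a v -> fdom a h ->
    u = v %[ae m] -> fval a u h = fval a v h ;
  df_zero : fdom a (cst 0) ;
  df_lin : forall (c : R) u v, fdom a u -> fdom a v ->
    fdom a (fun x => c * u x + v x) ;
  df_val_lin : forall (c : R) u v h, fdom a u -> fdom a v -> fdom a h ->
    fval a (fun x => c * u x + v x) h = c * fval a u h + fval a v h ;
  df_sym : forall u v, fdom a u -> fdom a v -> fval a u v = fval a v u ;
  df_ge0 : forall u, fdom a u -> 0 <= energy a u ;
  df_dense : forall f (e : R), L2 f -> 0 < e ->
    exists2 u, fdom a u & (L2norm (f \- u)%R < e%:E)%E ;
  df_closed : forall us, (forall n, fdom a (us n)) ->
    (forall e : R, 0 < e -> exists N, forall n k, (N <= n)%N -> (N <= k)%N ->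
       energy1 a (us n \- us k) < e) ->
    exists2 u, fdom a u & energy1 a (us n \- u) @[n --> \oo] --> (0 : R) ;
  df_markov : forall u, fdom a u ->
    let v := fun x => Num.min (Num.max (u x) 0) 1 in
    fdom a v /\ energy a v <= energy a u }.

Definition regular_form a :=
  (forall u (e : R), fdom a u -> 0 < e ->
     exists v, [/\ fdom a v, C0 v & energy1 a (u \- v) < e]) /\
  (forall f (e : R), C0 f -> 0 < e ->
     exists v, [/\ fdom a v, C0 v & forall x, `|f x - v x| < e]).

Record L2_semigroup T : Prop := {
  sg_L2 : forall t f, 0 <= t -> L2 f -> L2 (T t f) ;
  sg_lin : forall t (c : R) f g, 0 <= t -> L2 f -> L2 g ->
    T t (fun x => c * f x + g x) = (fun x => c * T t f x + T t g x) %[ae m] ;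
  sg_sym : forall t f g, 0 <= t -> L2 f -> L2 g ->
    inner (T t f) g = inner f (T t g) ;
  sg_0 : forall f, L2 f -> T 0 f = f %[ae m] ;
  sg_D : forall s t f, 0 <= s -> 0 <= t -> L2 f ->
    T (s + t) f = T s (T t f) %[ae m] ;
  sg_contr : forall t f, 0 <= t -> L2 f -> (L2norm (T t f) <= L2norm f)%E ;
  sg_cont : forall f, L2 f -> L2norm (T t f \- f) @[t --> 0^'+] --> 0%E }.

(* u is in D(A) and A u = f, where A is the infinitesimal generator of T. *)
Definition sg_generator T u f :=
  L2norm (fun x => t^-1 * (T t u x - u x) - f x) @[t --> 0^'+] --> 0%E.

(* T_t = exp (t A), where - A is the self-adjoint operator associated with the
   closed form a: u is in D(A) and A u = f iff u is in D(a) and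
   a(u, v) = (- f, v) for every v in D(a). *)
Definition semigroup_of a T :=
  L2_semigroup T /\
  forall u f, L2 u -> L2 f ->
    sg_generator T u f <->
    (fdom a u /\ forall v, fdom a v -> fval a u v = - inner f v).

Definition irreducible a :=
  forall T, semigroup_of a T ->
  forall A : set E, measurable A ->
    (forall (t : R) f, 0 < t -> L2 f ->
       T t (fun x => \1_A x * f x) = (fun x => \1_A x * T t f x) %[ae m]) ->
    m A = 0%E \/ m (~` A) = 0%E.

(* Boundedness is that of a class in L^1(E; m), i.e. m-a.e. *)
Definition reference_fun g :=
  [/\ g \in Lfun m 1,
      exists M : R, {ae m, forall x, `|g x| <= M} &
      {ae m, forall x, 0 < g x}].

Definition transient a :=
  exists2 g0, reference_fun g0 &
    forall u, fdom a u ->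
      (\int[m]_x (`|u x| * g0 x)%:E <= (Num.sqrt (energy a u))%:E)%E.

Definition cap_open a (O : set E) : \bar R :=
  ereal_inf [set (energy1 a u)%:E | u in
    [set u | fdom a u /\ {ae m, forall x, O x -> 1 <= u x}]].

Definition cap a (A : set E) : \bar R :=
  ereal_inf [set cap_open a O | O in [set O | open O /\ A `<=` O]].

Definition smooth a (mu : {measure set E -> \bar R}) :=
  (forall A, measurable A -> cap a A = 0%E -> mu A = 0%E) /\
  exists F : nat -> set E,
    [/\ forall n, closed (F n),
        forall n, F n `<=` F n.+1,
        forall n, (mu (F n) < +oo)%E &
        forall K, compact K -> cap a (K `\` F n) @[n --> \oo] --> 0%E].

Definition positive_semidefinite a := forall u, fdom a u -> 0 <= energy a u.

Definition closable a :=
  forall us, form_cauchy a us -> L2_cvg us (cst 0) ->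
    energy a (us n) @[n --> \oo] --> (0 : R).

Definition closure_approx a u us :=
  form_cauchy a us /\ L2_cvg us u.

(* When a is closable, the value below does not depend on the approximating
   sequences, and xget picks the unique element of the set. *)
Definition form_closure a : L2form E R := {|
  fdom := [set u | L2 u /\ exists us, closure_approx a u us] ;
  fval := fun u v => xget 0 [set r | exists us vs,
    [/\ closure_approx a u us, closure_approx a v vs &
        fval a (us n) (vs n) @[n --> \oo] --> r]] |}.

(* E^mu on D(E) \cap C_0(E), before taking the closure. *)
Definition schrodinger_core a (mu : {measure set E -> \bar R}) : L2form E R := {|
  fdom := fdom a `&` C0 ;
  fval := fun u v => fval a u v - \int[mu]_x (u x * v x) |}.

Definition schrodinger a mu : L2form E R := form_closure (schrodinger_core a mu).

Implicit Type w : E -> \bar R.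

(* Measurability for the m-completion of the Borel sigma-algebra. *)
Definition m_measurable w :=
  exists2 w' : E -> \bar R, measurable_fun setT w' & w = w' %[ae m].

Definition ext_approx a w us :=
  form_cauchy a us /\
  {ae m, forall x, (us n x)%:E @[n --> \oo] --> w x}.

Definition ext_dom a : set (E -> \bar R) :=
  [set w | [/\ m_measurable w,
               {ae m, forall x, (`|w x| < +oo)%E} &
               exists us, ext_approx a w us]].

(* A relation rather than a function of w, so that independence of the
   approximating sequence is not presupposed. *)
Definition ext_energy a w (r : R) :=
  exists2 us, ext_approx a w us & energy a (us n) @[n --> \oo] --> r.

Definition subcritical_fun a g :=
  reference_fun g /\
  forall w r, ext_dom a w -> ext_energy a w r ->
    (\int[m]_x (`|w x| * (g x)%:E) <= (Num.sqrt r)%:E)%E.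

Definition subcritical a := exists g, subcritical_fun a g.

(* S is the Riemann integral over [a0, b0] of the L^2-valued function F, i.e.
   the strong limit in L^2 of the Riemann sums over tagged partitions
   a0 = t_0 <= c_0 <= t_1 <= ... <= t_n = b0 when the mesh tends to 0. *)
Definition L2_integral (F : R -> E -> R) (a0 b0 : R) (S : E -> R) :=
  L2 S /\
  forall e : R, 0 < e -> exists2 delta : R, 0 < delta &
    forall (n : nat) (t c : nat -> R), t 0%N = a0 -> t n = b0 ->
      (forall i, (i < n)%N ->
         t i <= c i <= t i.+1 /\ t i.+1 - t i < delta) ->
      (L2norm (fun x => \sum_(i < n) (t i.+1 - t i) * F (c i) x - S x)%R
         < e%:E)%E.

(* G = \int_0^oo T_t g dt, the m-a.e. limit (in [-oo, +oo]) of the L^2-valued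
   integrals over [0, N]; these increase with N when g >= 0 and T is positivity
   preserving. *)
Definition potential T g (G : E -> \bar R) :=
  exists2 S : nat -> E -> R,
    forall N, L2_integral (fun t => T t g) 0 N%:R (S N) &
    {ae m, forall x, (S N x)%:E @[N --> \oo] --> G x}.

End forms.

(* Main.v *)
(* With S_N = int_0^N T_t g dt one has A S_N = T_N g - g for the generator A of T,
   hence, writing p_N = (S_N, g) and b for the closed form E^mu,
     b (S_N - S_M) = (T_M g - T_N g, S_N - S_M) = 2 p_(N+M) - p_(2M) - p_(2N).
   The semigroup being positivity preserving, p is nondecreasing, and the
   subcriticality inequality gives
     p_N <= int |S_N| g dm <= sqrt (b (S_N)) = sqrt (2 p_N - p_(2N)) <= sqrt p_N,
   so that p_N <= 1.  Thus (S_N) is b-Cauchy, and it increases to G, which is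
   finite a.e. since int |G| g dm <= 1 by Fatou's lemma.
   Positivity: u |-> u^+, u^- preserve the core, where b (u^+, u^-) <= 0 by the
   unit contraction property of E; hence (A u, u^-) >= 0 on the domain of A, and
   |(T_t u)^-| is nonincreasing in t. *)
Require Import Defs.
From HB Require Import structures.
From mathcomp Require Import all_boot all_order all_algebra.
From mathcomp Require Import all_classical all_reals all_analysis measurable_realfun.
From mathcomp Require Import ring lra.

Set Implicit Arguments.
Unset Strict Implicit.
Unset Printing Implicit Defensive.
Import Order.TTheory GRing.Theory Num.Theory.
Import numFieldNormedType.Exports.

Local Open Scope classical_set_scope.
Local Open Scope ring_scope.

(** * Semi-inner products on spaces of functions *)

(** The semigroup is given only through its generator and the description of the latter by the form.
    Neither spectral calculus nor bilinearity of the closed form is invoked: the energies of the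
    integrals S_N and of their differences are read off from A, and A S_N = T_N g - g is itself
    proved on Riemann sums, on which T_(jh) acts exactly by shifting indices. The form E^mu need not
    be Markovian, so positivity cannot come from a contraction property of its own. The sign of b
    (u^+, u^-), inherited from E, is available on the core only; it is carried to the closure as an
    inequality between L^2 inner products, without placing u^- in the domain of the closure. A
    general f >= 0 is not in the domain of A and is reached through the averages of T_s f over short
    intervals. Elements of L^2 are functions and not classes, so that [semi_inner] admits degenerate
    forms; it serves the inner products of L^2(m) and L^2(mu), the form E and the core of E^mu
    alike. *)

Record semi_inner (R : realType) (X : Type) (D : set (X -> R))
    (q : (X -> R) -> (X -> R) -> R) : Prop := {
  si_0 : D (cst 0) ;
  si_lin : forall (c : R) u v, D u -> D v -> D (fun x => c * u x + v x) ;
  si_val : forall (c : R) u v h, D u -> D v -> D h ->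
    q (fun x => c * u x + v x) h = c * q u h + q v h ;
  si_sym : forall u v, D u -> D v -> q u v = q v u ;
  si_ge0 : forall u, D u -> 0 <= q u u }.

Section semi_inner_theory.
Context {R : realType} {X : Type}.
Variables (D : set (X -> R)) (q : (X -> R) -> (X -> R) -> R).
Hypothesis Dq : semi_inner D q.
Implicit Types u v w : X -> R.

Definition seminorm u : R := Num.sqrt (q u u).

Lemma si_closedD u v : D u -> D v -> D (u \+ v).
Proof.
move=> Du Dv; rewrite (_ : u \+ v = (fun x => 1 * u x + v x)); last first.
  by apply/funext => x /=; rewrite mul1r.
exact: (si_lin Dq).
Qed.

Lemma si_closedZ c u : D u -> D (fun x => c * u x).
Proof.
move=> Du; rewrite (_ : (fun x => c * u x) = (fun x => c * u x + cst 0 x)).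
  by apply: (si_lin Dq) => //; exact: (si_0 Dq).
by apply/funext => x /=; rewrite addr0.
Qed.

Lemma si_closedB u v : D u -> D v -> D (u \- v).
Proof.
move=> Du Dv; rewrite (_ : u \- v = (fun x => (-1) * v x + u x)); last first.
  by apply/funext => x /=; rewrite mulN1r addrC.
exact: (si_lin Dq).
Qed.

Lemma si_closed_sum n (F : nat -> X -> R) : (forall i, (i < n)%N -> D (F i)) ->
  D (fun x => \sum_(i < n) F i x).
Proof.
elim: n => [_|n IH DF].
  rewrite (_ : (fun _ => _) = cst 0); first exact: (si_0 Dq).
  by apply/funext => x; rewrite big_ord0.
rewrite (_ : (fun _ => _) = (fun x => \sum_(i < n) F i x) \+ F n); last first.
  by apply/funext => x /=; rewrite big_ord_recr.
apply: si_closedD; last exact: DF.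
by apply: IH => i ni; apply: DF; rewrite ltnS ltnW.
Qed.

Lemma si_addl u v w : D u -> D v -> D w -> q (u \+ v) w = q u w + q v w.
Proof.
move=> Du Dv Dw; rewrite (_ : u \+ v = (fun x => 1 * u x + v x)); last first.
  by apply/funext => x /=; rewrite mul1r.
by rewrite (si_val Dq)// mul1r.
Qed.

Lemma si_subl u v w : D u -> D v -> D w -> q (u \- v) w = q u w - q v w.
Proof.
move=> Du Dv Dw; rewrite (_ : u \- v = (fun x => (-1) * v x + u x)); last first.
  by apply/funext => x /=; rewrite mulN1r addrC.
by rewrite (si_val Dq)// mulN1r addrC.
Qed.

Lemma si_0l w : D w -> q (cst 0) w = 0.
Proof.
move=> Dw; have D0 := si_0 Dq.
rewrite (_ : cst 0 = cst 0 \- cst 0); first by rewrite si_subl// subrr.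
by apply/funext => x /=; rewrite subrr.
Qed.

Lemma si_scalel c u w : D u -> D w -> q (fun x => c * u x) w = c * q u w.
Proof.
move=> Du Dw; rewrite (_ : (fun x => c * u x) = (fun x => c * u x + cst 0 x)).
  by rewrite (si_val Dq) ?si_0l ?addr0//; exact: (si_0 Dq).
by apply/funext => x /=; rewrite addr0.
Qed.

Lemma si_addr u v w : D u -> D v -> D w -> q w (u \+ v) = q w u + q w v.
Proof.
move=> Du Dv Dw; rewrite (si_sym Dq)//; last exact: si_closedD.
by rewrite si_addl// (si_sym Dq Du)// (si_sym Dq Dv).
Qed.

Lemma si_subr u v w : D u -> D v -> D w -> q w (u \- v) = q w u - q w v.
Proof.
move=> Du Dv Dw; rewrite (si_sym Dq)//; last exact: si_closedB.
by rewrite si_subl// (si_sym Dq Du)// (si_sym Dq Dv).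
Qed.

Lemma si_scaler c u w : D u -> D w -> q w (fun x => c * u x) = c * q w u.
Proof.
move=> Du Dw; rewrite (si_sym Dq)//; last exact: si_closedZ.
by rewrite si_scalel// (si_sym Dq Du).
Qed.

Lemma seminorm_ge0 u : 0 <= seminorm u.
Proof. exact: sqrtr_ge0. Qed.

Lemma seminorm_sq u : D u -> seminorm u ^+ 2 = q u u.
Proof. by move=> Du; rewrite sqr_sqrtr// (si_ge0 Dq). Qed.

(** The quadratic t |-> q (t u + v, t u + v) is nonnegative. As q may be degenerate, q (u, u) = 0 is
    a separate case. *)
Lemma cauchy_schwarz_sq u v : D u -> D v -> q u v ^+ 2 <= q u u * q v v.
Proof.
move=> Du Dv.
have H t : 0 <= t ^+ 2 * q u u + 2 * t * q u v + q v v.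
  have Dt := si_lin Dq t Du Dv.
  have := si_ge0 Dq Dt; rewrite (si_val Dq)// (si_sym Dq Du)//.
  rewrite (si_sym Dq Dv)// !(si_val Dq)// (si_sym Dq Dv)//.
  by move/le_trans; apply; rewrite le_eqVlt; apply/orP; left; apply/eqP; ring.
have := si_ge0 Dq Du; have := si_ge0 Dq Dv.
move: (q u u) (q u v) (q v v) H => A B C H C0 A0.
have [A00|A00] := eqVneq A 0.
  have [->|B0] := eqVneq B 0; first by rewrite A00 expr0n mul0r.
  (* At this t, with A = 0, the quadratic takes the value -1. *)
  have := H (- (C + 1) / (2 * B)).
  rewrite A00 mulr0 add0r (_ : 2 * _ * B = - (C + 1)); last by field.
  lra.
have Ap : 0 < A by rewrite lt_neqAle eq_sym A00.
have := H (- B / A).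
rewrite (_ : _ + C = (A * C - B ^+ 2) / A); last by field.
by rewrite pmulr_lge0 ?invr_gt0// subr_ge0.
Qed.

Lemma cauchy_schwarz u v : D u -> D v -> `|q u v| <= seminorm u * seminorm v.
Proof.
move=> Du Dv; rewrite /seminorm -sqrtrM ?(si_ge0 Dq)// -sqrtr_sqr.
by apply: ler_wsqrtr; exact: cauchy_schwarz_sq.
Qed.

Lemma seminormB_sq u v : D u -> D v ->
  seminorm (u \- v) ^+ 2 = seminorm u ^+ 2 - 2 * q u v + seminorm v ^+ 2.
Proof.
move=> Du Dv; have Duv := si_closedB Du Dv.
by rewrite !seminorm_sq// si_subl// !si_subr// (si_sym Dq Dv)//; ring.
Qed.

Lemma seminormD u v : D u -> D v -> seminorm (u \+ v) <= seminorm u + seminorm v.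
Proof.
move=> Du Dv; have Duv := si_closedD Du Dv.
rewrite -(@ler_pXn2r _ 2)// ?nnegrE ?addr_ge0 ?seminorm_ge0//.
rewrite seminorm_sq// si_addl// !si_addr// sqrrD !seminorm_sq// (si_sym Dq Dv)//.
have := le_trans (ler_norm _) (cauchy_schwarz Du Dv).
move: (seminorm u * seminorm v) => P; lra.
Qed.

Lemma seminormZ c u : D u -> seminorm (fun x => c * u x) = `|c| * seminorm u.
Proof.
move=> Du; rewrite /seminorm si_scalel// ?si_scaler//; last exact: si_closedZ.
by rewrite mulrA -expr2 sqrtrM ?sqr_ge0// sqrtr_sqr.
Qed.

Lemma seminorm_subC u v : D u -> D v -> seminorm (u \- v) = seminorm (v \- u).
Proof.
move=> Du Dv; rewrite (_ : u \- v = (fun x => (-1) * (v \- u) x)).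
  by rewrite seminormZ ?normrN1 ?mul1r//; exact: si_closedB.
by apply/funext => x /=; rewrite mulN1r opprB.
Qed.

Lemma seminorm_tri v u w : D u -> D v -> D w ->
  seminorm (u \- w) <= seminorm (u \- v) + seminorm (v \- w).
Proof.
move=> Du Dv Dw; rewrite (_ : u \- w = (u \- v) \+ (v \- w)).
  by apply: seminormD; exact: si_closedB.
by apply/funext => x /=; rewrite addrA subrK.
Qed.

Lemma seminorm_leB u v : D u -> D v -> seminorm u <= seminorm v + seminorm (u \- v).
Proof.
move=> Du Dv; rewrite [X in seminorm X <= _](_ : u = v \+ (u \- v)).
  by apply: seminormD => //; exact: si_closedB.
by apply/funext => x /=; rewrite addrC subrK.
Qed.

Lemma seminorm_sum n (F : nat -> X -> R) : (forall i, (i < n)%N -> D (F i)) ->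
  seminorm (fun x => \sum_(i < n) F i x) <= \sum_(i < n) seminorm (F i).
Proof.
elim: n => [_|n IH DF].
  rewrite big_ord0 (_ : (fun _ => _) = cst 0).
    by rewrite /seminorm si_0l ?sqrtr0//; exact: (si_0 Dq).
  by apply/funext => x; rewrite big_ord0.
rewrite (_ : (fun _ => _) = (fun x => \sum_(i < n) F i x) \+ F n); last first.
  by apply/funext => x /=; rewrite big_ord_recr.
have DFn i : (i < n)%N -> D (F i) by move=> ni; apply: DF; rewrite ltnS ltnW.
rewrite big_ord_recr/=; apply: le_trans (seminormD _ _) _.
- exact: si_closed_sum.
- exact: DF.
- by rewrite lerD2r IH.
Qed.

Lemma seminorm_null_ip u w : D u -> D w -> seminorm u = 0 -> q u w = 0.
Proof.
move=> Du Dw u0; have := cauchy_schwarz Du Dw.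
by rewrite u0 mul0r normr_le0 => /eqP.
Qed.

End semi_inner_theory.

(** * The space L^2 *)

Section L2_theory.
Context {R : realType} {d : measure_display} {E : borelMetricType R d}.
Variable m : {measure set E -> \bar R}.
Implicit Types f g u v : E -> R.

(** Serves twice: for the distance to the limit in the completeness of L^2, and for the finiteness
    of the potential. *)
Lemma fatou_le (f_ : nat -> E -> \bar R) (f : E -> \bar R) (c : \bar R) :
  (forall n, measurable_fun setT (f_ n)) -> measurable_fun setT f ->
  (forall n x, (0 <= f_ n x)%E) -> (forall x, (0 <= f x)%E) ->
  {ae m, forall x, f_ n x @[n --> \oo] --> f x} ->
  (forall n, (\int[m]_x f_ n x <= c)%E) -> (\int[m]_x f x <= c)%E.
Proof.
move=> mf_ mf f_0 f0 f_f f_c.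
have einf_ge0 x : (0 <= limn_einf (f_ ^~ x))%E.
  rewrite limn_einf_lim; apply: lime_ge; first exact: is_cvg_einfs.
  by apply: nearW => n; apply: le_ereal_inf_tmp => _ [k _ <-].
apply: (@le_trans _ _ (\int[m]_x limn_einf (f_ ^~ x))%E).
  apply: ae_ge0_le_integral => //.
    rewrite (_ : (fun x => _) = (fun x => - limn_esup (\- (f_ ^~ x)))%E)//.
    apply: measurableT_comp => //; apply: measurable_fun_limn_esup => n.
    exact: measurableT_comp.
  by apply: filterS f_f => x /cvg_limn_einf_sup[-> _] _.
apply: le_trans (fatou m measurableT mf_ (fun n x _ => f_0 n x)) _.
rewrite limn_einf_lim; apply: lime_le; first exact: is_cvg_einfs.
apply: nearW => n; apply: le_trans (f_c n).
by apply: ereal_inf_lbound; exists n => /=.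
Qed.

Lemma L2_meas f : L2 m f -> measurable_fun setT f.
Proof. by rewrite /L2/= inE => /andP[/[!inE]]. Qed.

Lemma L2_lin (c : R) f g : L2 m f -> L2 m g -> L2 m (fun x => c * f x + g x).
Proof.
move=> Lf Lg; have [_ /(_ c f g)] := Lfun_submod_closed m (lee1n 2).
exact.
Qed.

Lemma L2_0 : L2 m (cst 0).
Proof. by have [] := Lfun_submod_closed m (lee1n 2). Qed.

Lemma L2_mul_integrable f g : L2 m f -> L2 m g ->
  m.-integrable setT (EFin \o (f \* g)).
Proof. by move=> Lf Lg; apply/Lfun1_integrable; exact: Lfun2_mul_Lfun1. Qed.

Lemma L2_semi_inner : semi_inner (L2 m) (inner m).
Proof.
split.
- exact: L2_0.
- exact: L2_lin.
- move=> c u v h Lu Lv Lh; rewrite /inner.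
  under eq_Rintegral do rewrite mulrDl.
  rewrite RintegralD//; last exact: L2_mul_integrable.
    under eq_Rintegral do rewrite -mulrA.
    by rewrite RintegralZl//; exact: L2_mul_integrable.
  have Lcu : L2 m (fun x => c * u x + cst 0 x) by apply: L2_lin => //; exact: L2_0.
  have := L2_mul_integrable Lcu Lh.
  by under eq_fun do rewrite /= addr0.
- by move=> u v _ _; rewrite /inner; apply: eq_Rintegral => x _; rewrite mulrC.
- by move=> u _; apply: Rintegral_ge0 => x _; rewrite -expr2 sqr_ge0.
Qed.

Local Notation snorm := (seminorm (inner m)).

Lemma inner_EFin f : L2 m f ->
  (inner m f f)%:E = (\int[m]_x ((f x) ^+ 2)%:E)%E.
Proof.
move=> Lf; rewrite /inner /Rintegral fineK; last first.
  exact: integrable_fin_num (L2_mul_integrable Lf Lf).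
by apply: eq_integral => x _; rewrite expr2.
Qed.

Lemma Lnorm2E f : L2norm m f = (((\int[m]_x ((f x) ^+ 2)%:E) `^ 2^-1)%E).
Proof.
rewrite /L2norm unlock; congr (_ `^ _)%E; apply: eq_integral => x _ /=.
by rewrite powR_mulrn ?normr_ge0// real_normK// num_real.
Qed.

Lemma L2normE f : L2 m f -> L2norm m f = (snorm f)%:E.
Proof.
move=> Lf; rewrite Lnorm2E -inner_EFin// poweR_EFin powR12_sqrt//.
exact: si_ge0 L2_semi_inner _ Lf.
Qed.

Lemma L2I f : measurable_fun setT f -> (\int[m]_x ((f x) ^+ 2)%:E < +oo)%E -> L2 m f.
Proof.
move=> mf foo; rewrite /L2/= inE; apply/andP; split; rewrite inE//=.
rewrite /finite_norm -/(L2norm m f) Lnorm2E poweR_lty//.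
Qed.

Lemma snorm_le f c : L2 m f -> 0 <= c ->
  (\int[m]_x ((f x) ^+ 2)%:E <= (c ^+ 2)%:E)%E -> snorm f <= c.
Proof.
move=> Lf c0; rewrite -inner_EFin// lee_fin /seminorm => H.
by rewrite -(ger0_norm c0) -sqrtr_sqr ler_wsqrtr.
Qed.

Lemma snorm_eq0 f : L2 m f -> snorm f = 0 -> f = cst 0 %[ae m].
Proof.
move=> Lf f0.
have : (\int[m]_x `|((f x) ^+ 2)%:E| = 0)%E.
  under eq_integral do rewrite gee0_abs ?lee_fin ?sqr_ge0//.
  by rewrite -inner_EFin// -(seminorm_sq L2_semi_inner)// f0 expr0n.
move/(ae_eq_integral_abs m measurableT) => H.
apply: filterS (H _).
  by move=> x /= H1 _; have := H1 I => -[] /eqP; rewrite sqrf_eq0 => /eqP.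
apply/measurable_EFinP; apply: measurable_funX; exact: L2_meas.
Qed.

Lemma snorm_ae f g : L2 m f -> L2 m g -> f = g %[ae m] -> snorm (f \- g) = 0.
Proof.
move=> Lf Lg fg; have Lfg := si_closedB L2_semi_inner Lf Lg.
apply/eqP; rewrite eq_le seminorm_ge0 andbT; apply: snorm_le => //.
rewrite (ae_eq_integral (cst 0%E))//=; first by rewrite integral0 expr0n.
  apply/measurable_EFinP; apply: measurable_funX; exact: L2_meas.
by apply: filterS fg => x /= fg _; rewrite fg// subrr expr0n.
Qed.

Lemma le_snorm f g : L2 m f -> L2 m g -> (forall x, `|f x| <= `|g x|) ->
  snorm f <= snorm g.
Proof.
move=> Lf Lg fg; apply: ler_wsqrtr; rewrite -lee_fin !inner_EFin//.
apply: ge0_le_integral => //.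
- by move=> x _; rewrite lee_fin sqr_ge0.
- apply/measurable_EFinP; apply: measurable_funX; exact: L2_meas.
- apply/measurable_EFinP; apply: measurable_funX; exact: L2_meas.
- move=> x _; rewrite lee_fin -(real_normK (num_real (f x))).
  by rewrite -(real_normK (num_real (g x))) lerXn2r ?nnegrE.
Qed.

Lemma L2_dom f g : measurable_fun setT f -> L2 m g -> (forall x, `|f x| <= `|g x|) ->
  L2 m f.
Proof.
move=> mf Lg fg; apply: L2I => //.
apply: (@le_lt_trans _ _ (\int[m]_x ((g x) ^+ 2)%:E)%E); last first.
  by rewrite -inner_EFin// ltry.
apply: ge0_le_integral => //.
- by move=> x _; rewrite lee_fin sqr_ge0.
- by apply/measurable_EFinP; apply: measurable_funX.
- apply/measurable_EFinP; apply: measurable_funX; exact: L2_meas.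
- move=> x _; rewrite lee_fin -(real_normK (num_real (f x))).
  by rewrite -(real_normK (num_real (g x))) lerXn2r ?nnegrE.
Qed.

End L2_theory.

(** * Completeness of L^2 *)

Lemma cvgn_geometric_increments (R : realType) (v : nat -> R) (C : R) :
  0 <= C -> (forall k, `|v k.+1 - v k| <= C * (2^-1) ^+ k) -> cvgn v.
Proof.
move=> C0 vC.
have S : cvgn (series (telescope v)).
  apply: normed_cvg; apply: (@series_le_cvg _ _ (geometric C 2^-1)).
  - by move=> n /=.
  - by move=> n /=; rewrite mulr_ge0// exprn_ge0.
  - exact: vC.
  - by apply: is_cvg_geometric_series; rewrite ger0_norm// invf_lt1// ltr1n.
rewrite (_ : v = (fun n => v 0%N + series (telescope v) n)).
  by apply: is_cvgD => //; exact: is_cvg_cst.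
by apply/funext => n; exact: eq_sum_telescope.
Qed.

Section L2_complete.
Context {R : realType} {d : measure_display} {E : borelMetricType R d}.
Variable m : {measure set E -> \bar R}.
Local Notation snorm := (seminorm (inner m)).

Lemma nneseries_quarter :
  (\sum_(k <oo) ((4^-1 : R) ^+ k)%:E <= 2%:E)%E.
Proof.
apply: lime_le.
  by apply: is_cvg_nneseries => n _ _; rewrite lee_fin exprn_ge0.
apply: nearW => n; rewrite /= sumEFin lee_fin.
have -> : \sum_(0 <= i < n) (4^-1 : R) ^+ i = \sum_(i < n) (4^-1 : R) ^+ i.
  by rewrite big_mkord.
suff : \sum_(i < n) (4^-1 : R) ^+ i <= 2 - 2 * 4^-1 ^+ n.
  by move/le_trans; apply; rewrite gerBl mulr_ge0// exprn_ge0.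
elim: n => [|n IH]; first by rewrite big_ord0 expr0 mulr1 subrr.
rewrite big_ord_recr/= exprS.
have : 0 <= (4^-1 : R) ^+ n by rewrite exprn_ge0.
move: (4^-1 ^+ n) (\sum_(_ < _) _) IH => a b; lra.
Qed.

(** The series of the squares of 2^(k+1) (v_(k+1) - v_k) has integral at most the sum of the
    4^(1-k), so it is finite a.e. and bounds the increments by a multiple of 2^(-k). Working with
    squares keeps the estimate within L^2 when m is infinite. *)
Lemma ae_cvg_fast (v : nat -> E -> R) : (forall k, L2 m (v k)) ->
  (forall k, snorm (v k.+1 \- v k) <= (4^-1) ^+ k) ->
  {ae m, forall x, cvgn (v ^~ x)}.
Proof.
move=> Lv vv.
pose h k x := ((2 * (2 ^+ k)%R * (v k.+1 x - v k x)) ^+ 2)%:E.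
have LB k : L2 m (v k.+1 \- v k) by apply: (si_closedB (L2_semi_inner m)).
have mh k : measurable_fun setT (h k).
  apply/measurable_EFinP; apply: measurable_funX; apply: measurable_funM => //.
  exact: L2_meas (LB k).
have h0 k x : setT x -> (0 <= h k x)%E by rewrite lee_fin sqr_ge0.
have ih k : (\int[m]_x h k x <= (4 * (4^-1) ^+ k)%:E)%E.
  have -> : (\int[m]_x h k x = ((2 * 2 ^+ k * snorm (v k.+1 \- v k)) ^+ 2)%:E)%E.
    rewrite exprMn (seminorm_sq (L2_semi_inner m))// EFinM inner_EFin//.
    rewrite -ge0_integralZl//.
    - by apply: eq_integral => x _; rewrite /h exprMn EFinM.
    - apply/measurable_EFinP; apply: measurable_funX; exact: L2_meas.
    - by move=> x _; rewrite lee_fin sqr_ge0.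
  rewrite lee_fin.
  have -> : (2 * 2 ^+ k * snorm (v k.+1 \- v k)) ^+ 2 =
      4 * (4 ^+ k * snorm (v k.+1 \- v k) ^+ 2).
    by rewrite (_ : 4 = 2 ^+ 2 :> R) -?exprM 1?mulnC ?exprM; [ring|ring].
  have sk2 : snorm (v k.+1 \- v k) ^+ 2 <= (4^-1) ^+ k * (4^-1) ^+ k.
    by rewrite expr2 ler_pM// seminorm_ge0.
  rewrite ler_pM2l//; apply: le_trans (ler_wpM2l _ sk2) _; first exact: exprn_ge0.
  by rewrite mulrA -exprMn mulfV// expr1n mul1r.
have ifin : (\int[m]_x (\sum_(k <oo) h k x) < +oo)%E.
  rewrite integral_nneseries//.
  apply: (@le_lt_trans _ _ (\sum_(k <oo) (4%:E * ((4^-1 : R) ^+ k)%:E))%E).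
    apply: lee_nneseries => [k _ _|k _]; last by rewrite -EFinM ih.
    by apply: integral_ge0 => x; exact: h0.
  rewrite nneseriesZl//.
  apply: (@le_lt_trans _ _ (4%:E * 2%:E)%E); last by rewrite -EFinM ltry.
  by rewrite lee_pmul2l// nneseries_quarter.
have hint : m.-integrable setT (fun x => \sum_(k <oo) h k x)%E.
  apply/integrableP; split.
    by apply: (ge0_emeasurable_sum (P := xpredT)) => // k x Dx _; exact: h0.
  under eq_integral.
    move=> x _; rewrite gee0_abs; last by apply: nneseries_ge0 => k *; exact: h0.
    over.
  exact: ifin.
apply: filterS (integrable_ae measurableT hint) => x /(_ I) fx.
pose M := fine (\sum_(k <oo) h k x)%E.
have hM k : (2 * 2 ^+ k * (v k.+1 x - v k x)) ^+ 2 <= M.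
  rewrite -lee_fin fineK//.
  have := @nneseries_lim_ge R (fun k => h k x) xpredT 0 k.+1 _.
  move=> /(_ (fun k _ _ => h0 k x I)).
  apply: le_trans; rewrite big_nat_recr//= leeDr//.
  by apply: sume_ge0 => i _; exact: h0.
apply: (@cvgn_geometric_increments _ _ (Num.sqrt M)) => // k.
have := ler_wsqrtr (hM k); rewrite sqrtr_sqr normrM.
rewrite ger0_norm ?mulr_ge0 ?exprn_ge0// => H.
rewrite exprVn ler_pdivlMr ?exprn_gt0//.
apply: le_trans H; rewrite mulrC ler_wpM2r//.
by rewrite ler_peMl ?exprn_ge0// ler1n.
Qed.

Lemma L2_complete (us : nat -> E -> R) : (forall n, L2 m (us n)) ->
  (forall e, 0 < e -> exists N, forall n k, (N <= n)%N -> (N <= k)%N ->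
    snorm (us n \- us k) < e) ->
  exists2 u, L2 m u & forall e, 0 < e -> exists N, forall n, (N <= n)%N ->
    snorm (us n \- u) <= e.
Proof.
move=> Lus us_cauchy.
have q0 k : 0 < (4^-1 : R) ^+ k by rewrite exprn_gt0.
have [N HN] := choice (fun k => us_cauchy _ (q0 k)).
(* Summing the thresholds makes [s] monotone and at least [N k]; the extra term makes it at least
   [k]. *)
pose s k := (\sum_(i < k.+1) N i + k)%N.
have sN k : (N k <= s k)%N by rewrite /s big_ord_recr/= -addnA addnCA leq_addr.
have sS k : (s k <= s k.+1)%N by rewrite /s leq_add// [leqRHS]big_ord_recr/= leq_addr.
pose v k := us (s k).
have Lv k : L2 m (v k) by exact: Lus.
have vv k : snorm (v k.+1 \- v k) <= (4^-1) ^+ k.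
  by apply: ltW; apply: HN => //; exact: leq_trans (sN k) (sS k).
(* The upper limit is measurable with no exceptional set, and [fine] makes it real also where the
   sequence diverges. *)
pose u x := fine (limn_esup (fun k => (v k x)%:E)).
have mu : measurable_fun setT u.
  apply: measurableT_comp => //; apply: measurable_fun_limn_esup => n.
  apply/measurable_EFinP; exact: L2_meas (Lv n).
have vu : {ae m, forall x, v k x @[k --> \oo] --> u x}.
  apply: filterS (ae_cvg_fast Lv vv) => x /cvg_ex[l vl].
  have /cvg_limn_einf_sup[_ ul] : (v k x)%:E @[k --> \oo] --> l%:E.
    by apply: cvg_EFin => //; exact: nearW.
  by rewrite /u ul.
have key e : 0 < e -> exists N0, forall n, (N0 <= n)%N ->
    (\int[m]_x ((us n x - u x) ^+ 2)%:E <= (e ^+ 2)%:E)%E.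
  move=> e0; have [N0 HN0] := us_cauchy e e0; exists N0 => n Nn.
  (* The shift by [N0] puts every index [s (k + N0)] past the Cauchy threshold [N0]. *)
  apply: (@fatou_le _ _ _ m (fun k x => ((us n x - v (k + N0)%N x) ^+ 2)%:E)).
  - move=> k; apply/measurable_EFinP; apply: measurable_funX.
    by apply: measurable_funB; apply: L2_meas.
  - apply/measurable_EFinP; apply: measurable_funX.
    by apply: measurable_funB => //; exact: L2_meas.
  - by move=> k x; rewrite lee_fin sqr_ge0.
  - by move=> x; rewrite lee_fin sqr_ge0.
  - apply: filterS vu => x vux; apply: cvg_EFin; first exact: nearW.
    apply: (@cvg_comp _ _ _ _ (fun r => r ^+ 2)); last first.
      exact: exprn_continuous.
    apply: cvgB; first exact: cvg_cst.
    by rewrite -(cvg_shiftn N0) in vux.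
  - move=> k; have LB : L2 m (us n \- v (k + N0)%N) by apply: (si_closedB (L2_semi_inner m)).
    rewrite -(inner_EFin LB) lee_fin -(seminorm_sq (L2_semi_inner m))//.
    rewrite lerXn2r ?nnegrE ?seminorm_ge0 ?(ltW e0)// ltW// HN0//.
    by rewrite /s addnA leq_addl.
have Lu : L2 m u.
  have [N0 /(_ N0 (leqnn _)) H] := key 1 ltr01.
  have LB : L2 m (us N0 \- u).
    apply: L2I; first by apply: measurable_funB => //; exact: L2_meas.
    by apply: le_lt_trans H _; rewrite ltry.
  rewrite (_ : u = us N0 \- (us N0 \- u)); first by apply: (si_closedB (L2_semi_inner m)).
  by apply/funext => x /=; rewrite opprB addrC subrK.
exists u => // e e0; have [N0 HN0] := key e e0; exists N0 => n Nn.
apply: snorm_le; [by apply: (si_closedB (L2_semi_inner m))|exact: ltW|exact: HN0].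
Qed.

End L2_complete.

(** * Riemann integration in L^2 *)

Section overlap.
Context {R : realType}.
Implicit Types lo hi l h x : R.

Definition clamp lo hi x := Num.min (Num.max x lo) hi.

(* The length of [lo, hi] `&` [l, h]. *)
Definition overlap lo hi l h := clamp lo hi h - clamp lo hi l.

Lemma overlapC lo hi l h : lo <= hi -> l <= h -> overlap lo hi l h = overlap l h lo hi.
Proof.
rewrite /overlap /clamp !minEle !maxEle => ? ?.
by repeat case: ifPn; rewrite -?ltNge => *; lra.
Qed.

Lemma overlap_ge0 lo hi l h : lo <= hi -> l <= h -> 0 <= overlap lo hi l h.
Proof.
rewrite /overlap /clamp !minEle !maxEle => ? ?.
by repeat case: ifPn; rewrite -?ltNge => *; lra.
Qed.

Lemma overlap_neq0 lo hi l h : lo <= hi -> l <= h -> overlap lo hi l h != 0 ->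
  l < hi /\ lo < h.
Proof.
rewrite /overlap /clamp !minEle !maxEle => ? ? /eqP H; split; apply: contra_notT H;
by rewrite -leNgt; repeat case: ifPn; rewrite -?ltNge => *; lra.
Qed.

(** The clamped nodes telescope, from [lo] at the first one to [hi] at the last. *)
Lemma sum_overlap lo hi (s : nat -> R) n : lo <= hi -> s 0%N <= lo -> hi <= s n ->
  \sum_(j < n) overlap lo hi (s j) (s j.+1) = hi - lo.
Proof.
move=> lohi s0 sn.
rewrite -(big_mkord xpredT (fun j => overlap lo hi (s j) (s j.+1))) /overlap.
rewrite (telescope_sumr (fun j => clamp lo hi (s j)))//.
by rewrite /clamp (max_idPl _) ?(le_trans lohi)// (min_idPr _)// (max_idPr _)// (min_idPl _).
Qed.

End overlap.

Lemma archi_div (R : realType) (x e : R) : 0 < e ->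
  exists N, forall n, (N <= n)%N -> x / n.+1%:R < e.
Proof.
move=> e0; exists (Num.bound (`|x| / e)) => n Nn.
rewrite ltr_pdivrMr// mulrC -ltr_pdivrMr//.
apply: le_lt_trans (_ : `|x| / e < _).
  by rewrite ler_pM2r ?invr_gt0// ler_norm.
apply: lt_le_trans (archi_boundP _) _; first by rewrite divr_ge0// ltW.
by rewrite ler_nat leqW.
Qed.

Section riemann.
Context {R : realType} {d : measure_display} {E : borelMetricType R d}.
Variable m : {measure set E -> \bar R}.
Local Notation snorm := (seminorm (inner m)).
Local Notation LI := (L2_semi_inner m).
Variable F : R -> E -> R.

Definition riemann_sum (n : nat) (t c : nat -> R) : E -> R :=
  fun x => \sum_(i < n) (t i.+1 - t i) * F (c i) x.

Definition tagged_partition (a b delta : R) (n : nat) (t c : nat -> R) :=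
  [/\ t 0%N = a, t n = b & forall i, (i < n)%N ->
     t i <= c i <= t i.+1 /\ t i.+1 - t i < delta].

Lemma tagged_partition_homo a b delta n t c i j : tagged_partition a b delta n t c ->
  (i <= j)%N -> (j <= n)%N -> t i <= t j.
Proof.
move=> [_ _ tc]; elim: j => [|j IH]; first by rewrite leqn0 => /eqP->.
rewrite leq_eqVlt => /orP[/eqP->//|]; rewrite ltnS => /IH ij jn.
apply: (le_trans (ij (ltnW jn))).
by have [/andP[h1 h2] _] := tc j jn; exact: le_trans h2.
Qed.

Lemma tagged_partition_bnd a b delta n t c i : tagged_partition a b delta n t c ->
  (i < n)%N -> a <= c i <= b.
Proof.
move=> P ni; have [t0 tn tc] := P; have [/andP[h1 h2] _] := tc i ni.
rewrite -t0 -tn (le_trans (tagged_partition_homo P (leq0n i) (ltnW ni)) h1)/=.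
exact: le_trans h2 (tagged_partition_homo P ni (leqnn n)).
Qed.

Variables (a b : R).
Hypothesis ab : a <= b.
Hypothesis LF : forall c, a <= c <= b -> L2 m (F c).

Lemma L2_riemann_sum delta n t c : tagged_partition a b delta n t c ->
  L2 m (riemann_sum n t c).
Proof.
move=> P; apply: (si_closed_sum LI (F := fun i x => (t i.+1 - t i) * F (c i) x)) => i ni.
by apply: (si_closedZ LI); apply: LF; exact: tagged_partition_bnd P ni.
Qed.

(* Both sums are written over the common refinement with weights the lengths of
   the pairwise intersections of the two subdivisions. *)
Lemma riemann_sum_dist (d1 d2 e : R) n t c k s c' :
  tagged_partition a b d1 n t c -> tagged_partition a b d2 k s c' ->
  (forall x y, a <= x <= b -> a <= y <= b -> `|x - y| < d1 + d2 ->
     snorm (F x \- F y) <= e) ->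
  snorm (riemann_sum n t c \- riemann_sum k s c') <= (b - a) * e.
Proof.
move=> P Q Fe; have [t0 tn tc] := P; have [s0 sk sc] := Q.
pose lam (i j : nat) := overlap (t i) (t i.+1) (s j) (s j.+1).
have tS i : (i < n)%N -> t i <= t i.+1.
  by move=> ni; exact: (tagged_partition_homo P).
have sS j : (j < k)%N -> s j <= s j.+1.
  by move=> jk; exact: (tagged_partition_homo Q).
have tab i : (i <= n)%N -> a <= t i <= b.
  by move=> ni; rewrite -t0 -tn !(tagged_partition_homo P).
have sab j : (j <= k)%N -> a <= s j <= b.
  by move=> nj; rewrite -s0 -sk !(tagged_partition_homo Q).
have lam_i i : (i < n)%N -> \sum_(j < k) lam i j = t i.+1 - t i.
  move=> ni; rewrite sum_overlap ?tS// ?s0 ?sk.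
    by have /andP[] := tab i (ltnW ni).
  by have /andP[] := tab _ ni.
have lam_j j : (j < k)%N -> \sum_(i < n) lam i j = s j.+1 - s j.
  move=> jk; under eq_bigr => i _ do rewrite /lam overlapC ?tS ?sS//.
  rewrite sum_overlap ?sS// ?t0 ?tn.
    by have /andP[] := sab j (ltnW jk).
  by have /andP[] := sab _ jk.
pose H i j x := lam i j * (F (c i) x - F (c' j) x).
have LH i j : (i < n)%N -> (j < k)%N -> L2 m (H i j).
  move=> ni jk; apply: (si_closedZ LI _ (u := F (c i) \- F (c' j))).
  apply: (si_closedB LI); apply: LF.
    exact: tagged_partition_bnd P ni.
  exact: tagged_partition_bnd Q jk.
have -> : riemann_sum n t c \- riemann_sum k s c' =
    (fun x => \sum_(i < n) (\sum_(j < k) H i j x)).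
  apply/funext => x /=; rewrite /riemann_sum.
  under [X in X - _ = _]eq_bigr => i _ do rewrite -lam_i// mulr_suml.
  under [X in _ - X = _]eq_bigr => j _ do rewrite -lam_j// mulr_suml.
  rewrite [X in _ - X = _]exchange_big/= -sumrB; apply: eq_bigr => i _.
  by rewrite -sumrB; apply: eq_bigr => j _; rewrite /H mulrBr.
apply: le_trans (seminorm_sum LI (F := fun i x => \sum_(j < k) H i j x) _) _.
  by move=> i ni; apply: (si_closed_sum LI (F := H i)) => j jk; exact: LH.
have -> : (b - a) * e = \sum_(i < n) (\sum_(j < k) lam i j * e).
  under eq_bigr => i _ do rewrite -mulr_suml lam_i//.
  rewrite -mulr_suml -(big_mkord xpredT (fun i => t i.+1 - t i)).
  by rewrite telescope_sumr// t0 tn.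
apply: ler_sum => i _.
apply: le_trans (seminorm_sum LI (F := H i) _) _; first by move=> j jk; exact: LH.
apply: ler_sum => j _.
have lij : 0 <= lam i j by apply: overlap_ge0; [exact: tS|exact: sS].
rewrite (seminormZ LI _ (u := F (c i) \- F (c' j))); last first.
  apply: (si_closedB LI); apply: LF.
    exact: tagged_partition_bnd P (ltn_ord i).
  exact: tagged_partition_bnd Q (ltn_ord j).
rewrite ger0_norm//.
have [->|l0] := eqVneq (lam i j) 0; first by rewrite !mul0r.
(* Only overlapping pieces contribute, and the tags of two such pieces are less than [d1 + d2]
   apart. *)
have [h1 h2] := overlap_neq0 (tS i (ltn_ord i)) (sS j (ltn_ord j)) l0.
rewrite ler_wpM2l// Fe//.
- exact: tagged_partition_bnd P (ltn_ord i).
- exact: tagged_partition_bnd Q (ltn_ord j).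
- have [/andP[? ?] ?] := tc i (ltn_ord i).
  have [/andP[? ?] ?] := sc j (ltn_ord j).
  rewrite ltr_norml; lra.
Qed.

Lemma uniform_partition (n : nat) (h delta : R) : 0 <= h -> h < delta ->
  n%:R * h = b - a ->
  tagged_partition a b delta n (fun i => a + i%:R * h) (fun i => a + i%:R * h).
Proof.
move=> h0 hd nh; split.
- by rewrite mul0r addr0.
- by rewrite nh addrC subrK.
- by move=> i _; rewrite -natr1; lra.
Qed.

Hypothesis cF : forall e : R, 0 < e -> exists2 delta : R, 0 < delta &
  forall x y, a <= x <= b -> a <= y <= b -> `|x - y| < delta ->
    snorm (F x \- F y) <= e.

(** Uniform subdivisions give a Cauchy sequence; its limit is compared with an arbitrary fine tagged
    partition through one of these subdivisions. *)
Lemma L2_integral_exists : exists S, L2_integral m F a b S.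
Proof.
(* The added 1 allows for [a = b] in the divisions to come. *)
have ba0 : 0 < b - a + 1 by rewrite ltr_wpDl// subr_ge0.
have small e : 0 < e -> (b - a) * (e / (b - a + 1)) <= e.
  move=> e0; rewrite mulrA ler_pdivrMr// mulrC ler_pM2l//; lra.
pose us n := riemann_sum n.+1 (fun i => a + i%:R * ((b - a) / n.+1%:R))
                         (fun i => a + i%:R * ((b - a) / n.+1%:R)).
have Pus n delta : (b - a) / n.+1%:R < delta ->
    tagged_partition a b delta n.+1 (fun i => a + i%:R * ((b - a) / n.+1%:R))
                         (fun i => a + i%:R * ((b - a) / n.+1%:R)).
  move=> nd; apply: uniform_partition => //; first by rewrite divr_ge0// subr_ge0.
  by rewrite mulrC divfK.
have Lus n : L2 m (us n).
  by apply: L2_riemann_sum (Pus n ((b - a) / n.+1%:R + 1) _); rewrite ltrDl.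
have us_cauchy (e : R) : 0 < e -> exists N, forall n k, (N <= n)%N -> (N <= k)%N ->
    snorm (us n \- us k) < e.
  move=> e0; have e20 : 0 < e / 2 by rewrite divr_gt0.
  have [|delta d0 Hd] := cF (e := e / 2 / (b - a + 1)); first by rewrite divr_gt0.
  have [|N HN] := @archi_div R (b - a) (delta / 2); first by rewrite divr_gt0.
  exists N => n k Nn Nk; apply: (@le_lt_trans _ _ (e / 2)); last by lra.
  apply: le_trans (small _ e20).
  apply: riemann_sum_dist (Pus n _ (HN _ Nn)) (Pus k _ (HN _ Nk)) _ => x y ax ay xy.
  by apply: Hd => //; lra.
have [S LS HS] := L2_complete Lus us_cauchy.
exists S; split=> // e e0; have e30 : 0 < e / 3 by rewrite divr_gt0.
have [|delta d0 Hd] := cF (e := e / 3 / (b - a + 1)); first by rewrite divr_gt0.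
(* Two meshes below [delta / 2] put overlapping tags within [delta] of each other. *)
exists (delta / 2); first by rewrite divr_gt0.
move=> n t c t0 tn tc.
have P : tagged_partition a b (delta / 2) n t c by [].
have LP := L2_riemann_sum P.
have [|N HN] := @archi_div R (b - a) (delta / 2); first by rewrite divr_gt0.
have [N' HN'] := HS _ e30; pose k := maxn N N'.
rewrite -[X in L2norm m X]/(riemann_sum n t c \- S) L2normE; last exact: (si_closedB LI).
rewrite lte_fin; apply: le_lt_trans (seminorm_tri LI LP (Lus k) LS) _.
have h1 : snorm (us k \- S) <= e / 3 by apply: HN'; rewrite leq_maxr.
have h2 : snorm (riemann_sum n t c \- us k) <= e / 3.
  apply: le_trans (small _ e30).
  apply: riemann_sum_dist P (Pus k _ (HN k (leq_maxl _ _))) _ => x y ax ay xy.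
  by apply: Hd => //; lra.
lra.
Qed.

End riemann.

(** * Semigroups on L^2 and their generators *)

Section semigroup_theory.
Context {R : realType} {d : measure_display} {E : borelMetricType R d}.
Variable m : {measure set E -> \bar R}.
Local Notation snorm := (seminorm (inner m)).
Local Notation LI := (L2_semi_inner m).
Implicit Types f g u v : E -> R.

Lemma inner_ae f f' g : L2 m f -> L2 m f' -> L2 m g -> f = f' %[ae m] ->
  inner m f g = inner m f' g.
Proof.
move=> Lf Lf' Lg ff'; apply/eqP; rewrite -subr_eq0 -(si_subl LI)//.
by rewrite (seminorm_null_ip LI)//; [exact: (si_closedB LI)|exact: snorm_ae].
Qed.

Lemma snorm_ae_eq f f' : L2 m f -> L2 m f' -> f = f' %[ae m] -> snorm f = snorm f'.
Proof.
move=> Lf Lf' ff'; rewrite /seminorm (inner_ae Lf Lf' Lf ff').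
by rewrite (si_sym LI)// (inner_ae Lf Lf' Lf' ff').
Qed.

Lemma snorm_sum_near n (h e : R) (G : nat -> E -> R) f : 0 <= h -> L2 m f ->
  (forall i, (i < n)%N -> L2 m (G i)) ->
  (forall i, (i < n)%N -> snorm (G i \- f) <= e) ->
  snorm ((fun x => \sum_(i < n) h * G i x) \- (fun x => (n%:R * h) * f x))
    <= n%:R * h * e.
Proof.
move=> h0 Lf LG Ge.
rewrite (_ : _ \- _ = (fun x => \sum_(i < n) h * (G i \- f) x)); last first.
  apply/funext => x /=; under [RHS]eq_bigr do rewrite mulrBr.
  by rewrite sumrB sumr_const card_ord -mulrA mulr_natl.
have LB i : (i < n)%N -> L2 m (G i \- f) by move=> ni; apply: (si_closedB LI) => //; exact: LG.
apply: le_trans (seminorm_sum LI (F := fun i x => h * (G i \- f) x) _) _.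
  by move=> i ni; apply: (si_closedZ LI); exact: LB.
rewrite (_ : n%:R * h * e = \sum_(i < n) h * e); last first.
  by rewrite sumr_const card_ord -mulrA mulr_natl.
apply: ler_sum => i _; rewrite (seminormZ LI); last exact: LB.
by rewrite ger0_norm// ler_wpM2l// Ge.
Qed.

Lemma L2_cvg0P (I : Type) (F : set_system I) (FF : Filter F) (us : I -> E -> R) :
  (\forall x \near F, L2 m (us x)) ->
  L2norm m (us x) @[x --> F] --> 0%E <->
  forall e : R, 0 < e -> \forall x \near F, snorm (us x) <= e.
Proof.
move=> Lus; split => [H e e0|H].
  have /H : nbhs (0%:E : \bar R) [set y | (y < e%:E)%E].
    exact: (@nbhs_open_ereal_lt _ 0 (fun=> e)).
  rewrite near_simpl; apply: filterS2 Lus => x Lx /=.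
  by rewrite L2normE// lte_fin => /ltW.
apply: (@cvg_trans _ ((snorm (us x))%:E @[x --> F])).
  by apply: near_eq_cvg; apply: filterS Lus => x Lx; rewrite L2normE.
apply: cvg_EFin; first exact: nearW.
apply/cvgrPdist_le => e e0; apply: filterS (H e e0) => x xe.
by rewrite sub0r normrN ger0_norm// seminorm_ge0.
Qed.

Variable T : R -> (E -> R) -> (E -> R).
Hypothesis TS : L2_semigroup m T.

Lemma semigroup_L2 t f : 0 <= t -> L2 m f -> L2 m (T t f).
Proof. by move=> t0 Lf; apply: (sg_L2 TS). Qed.

Lemma semigroup_contr t f : 0 <= t -> L2 m f -> snorm (T t f) <= snorm f.
Proof.
move=> t0 Lf; have := sg_contr TS t0 Lf.
by rewrite !L2normE// ?lee_fin//; exact: semigroup_L2.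
Qed.

Lemma semigroup_lin t c f g : 0 <= t -> L2 m f -> L2 m g ->
  T t (fun x => c * f x + g x) = (fun x => c * T t f x + T t g x) %[ae m].
Proof. by move=> t0 Lf Lg; apply: (sg_lin TS). Qed.

Lemma semigroupB t f g : 0 <= t -> L2 m f -> L2 m g ->
  T t (f \- g) = T t f \- T t g %[ae m].
Proof.
move=> t0 Lf Lg; have := semigroup_lin (-1) t0 Lg Lf.
rewrite (_ : f \- g = (fun x => -1 * g x + f x)); last first.
  by apply/funext => x /=; rewrite mulN1r addrC.
by apply: filterS => x /[apply] ->; rewrite mulN1r addrC.
Qed.

Lemma semigroup0 t : 0 <= t -> T t (cst 0) = cst 0 %[ae m].
Proof.
move=> t0; have L0 := L2_0 m.
apply: snorm_eq0; first exact: semigroup_L2.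
apply/eqP; rewrite eq_le seminorm_ge0 andbT.
by apply: le_trans (semigroup_contr t0 L0) _; rewrite /seminorm (si_0l LI)// sqrtr0.
Qed.

Lemma semigroupZ t c f : 0 <= t -> L2 m f ->
  T t (fun x => c * f x) = (fun x => c * T t f x) %[ae m].
Proof.
move=> t0 Lf; have := semigroup_lin c t0 Lf (L2_0 m).
rewrite (_ : (fun x => c * f x + cst 0 x) = (fun x => c * f x)); last first.
  by apply/funext => x /=; rewrite addr0.
move=> H; have H0 := semigroup0 t0.
by apply: filterS2 H H0 => x /(_ I) -> /(_ I) -> _; rewrite addr0.
Qed.

Lemma semigroup_dist t f g : 0 <= t -> L2 m f -> L2 m g ->
  snorm (T t f \- T t g) <= snorm (f \- g).
Proof.
move=> t0 Lf Lg.
have LB : L2 m (f \- g) by exact: (si_closedB LI).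
rewrite -(snorm_ae_eq _ _ (semigroupB t0 Lf Lg)); [|exact: semigroup_L2|].
  exact: semigroup_contr.
by apply: (si_closedB LI); exact: semigroup_L2.
Qed.

(** The limit at 0^+ leaves out h = 0, which T_0 f = f a.e. supplies. *)
Lemma semigroup_cont0 f (e : R) : L2 m f -> 0 < e ->
  exists2 delta : R, 0 < delta &
    forall h, 0 <= h -> h < delta -> snorm (T h f \- f) <= e.
Proof.
move=> Lf e0.
have LB t : 0 <= t -> L2 m (T t f \- f).
  by move=> t0; apply: (si_closedB LI) => //; exact: semigroup_L2.
have : \forall t \near (0 : R)^'+, snorm (T t f \- f) <= e.
  have := sg_cont TS Lf; move/L2_cvg0P; apply => //.
  by near=> t; apply: LB; near: t; exact: nbhs_right_ge.
move=> [delta /= d0 H]; exists delta => // h; rewrite le_eqVlt => /predU1P[<- _|h0 hd].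
  by rewrite snorm_ae ?ltW//; [exact: semigroup_L2|exact: sg_0 TS _ Lf].
by apply: H => //=; rewrite sub0r normrN gtr0_norm.
Unshelve. all: end_near. Qed.

Lemma semigroupD s t f : 0 <= s -> 0 <= t -> L2 m f -> T (s + t) f = T s (T t f) %[ae m].
Proof. exact: (sg_D TS). Qed.

(** T_t f - T_s f = T_s (T_(t-s) f - f) a.e. and T_s is a contraction. Strong continuity at 0
    thereby becomes uniform continuity in time. *)
Lemma semigroup_modulus s t f : 0 <= s -> s <= t -> L2 m f ->
  snorm (T t f \- T s f) <= snorm (T (t - s) f \- f).
Proof.
move=> s0 st Lf; have ts0 : 0 <= t - s by rewrite subr_ge0.
have t0 := le_trans s0 st.
have LB : L2 m (T s (T (t - s) f) \- T s f) by apply: (si_closedB LI); do ?apply: semigroup_L2.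
rewrite (snorm_ae_eq (f' := T s (T (t - s) f) \- T s f))//.
- by apply: semigroup_dist => //; exact: semigroup_L2.
- by apply: (si_closedB LI); exact: semigroup_L2.
- have := semigroupD s0 ts0 Lf; rewrite subrKC.
  by apply: filterS => x /[apply] /= ->.
Qed.

Lemma semigroup_unif_cont f (e : R) : L2 m f -> 0 < e ->
  exists2 delta : R, 0 < delta &
    forall s t, 0 <= s -> 0 <= t -> `|s - t| < delta -> snorm (T s f \- T t f) <= e.
Proof.
move=> Lf e0; have [delta d0 H] := semigroup_cont0 Lf e0; exists delta => // s t s0 t0.
have [st|/ltW ts] := leP s t.
  rewrite distrC ger0_norm ?subr_ge0// => std.
  rewrite (seminorm_subC LI)//; [|exact: semigroup_L2|exact: semigroup_L2].
  by apply: le_trans (semigroup_modulus s0 st Lf) _; apply: H; rewrite ?subr_ge0.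
rewrite ger0_norm ?subr_ge0// => std.
by apply: le_trans (semigroup_modulus t0 ts Lf) _; apply: H; rewrite ?subr_ge0.
Qed.

Lemma semigroup_integral_exists f (tau : R) : 0 <= tau -> L2 m f ->
  exists S, L2_integral m (T^~ f) 0 tau S.
Proof.
move=> tau0 Lf; apply: L2_integral_exists => //.
  by move=> c /andP[c0 _]; exact: semigroup_L2.
move=> e e0; have [delta d0 H] := semigroup_unif_cont Lf e0; exists delta => // x y.
by move=> /andP[x0 _] /andP[y0 _]; exact: H.
Qed.

(** Left Riemann sum of t |-> T_t f over [0, n h]; steps are equal so that T_(jh) maps nodes to
    nodes. *)
Definition step_sum (h : R) (n : nat) f : E -> R := fun x => \sum_(i < n) h * T (i%:R * h) f x.

Lemma L2_step_sum h n f : 0 <= h -> L2 m f -> L2 m (step_sum h n f).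
Proof.
move=> h0 Lf; apply: (si_closed_sum LI (F := fun i x => h * T (i%:R * h) f x)) => i _.
by apply: (si_closedZ LI); apply: semigroup_L2; rewrite ?mulr_ge0.
Qed.

Lemma L2_integral_step_sum f (tau : R) S : L2 m f -> 0 <= tau ->
  L2_integral m (T^~ f) 0 tau S -> forall e : R, 0 < e ->
  exists2 delta : R, 0 < delta &
    forall h n, 0 <= h -> h < delta -> n%:R * h = tau -> snorm (step_sum h n f \- S) < e.
Proof.
move=> Lf tau0 [LS HS] e e0; have [delta d0 H] := HS e e0.
exists delta => // h n h0 hd nh.
have [t0 tn tc] : tagged_partition 0 tau delta n (fun i => 0 + i%:R * h) (fun i => 0 + i%:R * h).
  by apply: uniform_partition => //; rewrite subr0.
have := H n _ _ t0 tn tc.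
rewrite (_ : (fun x => _) = step_sum h n f \- S); last first.
  apply/funext => x /=; congr (_ - _); apply: eq_bigr => i _.
  by rewrite !add0r -mulrBl -natr1 addrC addKr mul1r.
by rewrite L2normE ?lte_fin//; apply: (si_closedB LI) => //; exact: L2_step_sum.
Qed.

(** Discrete form, with no error term, of the fact that T_s turns the integral over [0, tau] into
    the one over [s, s + tau]: T_(jh) sends the node i to the node i + j. *)
Lemma semigroup_step_sum j h n f : 0 <= h -> L2 m f ->
  T (j%:R * h) (step_sum h n f) = step_sum h (j + n) f \- step_sum h j f %[ae m].
Proof.
move=> h0 Lf; have jh0 : 0 <= j%:R * h by rewrite mulr_ge0.
elim: n => [|n IH].
  rewrite (_ : step_sum h 0 f = cst 0); last by apply/funext => x; rewrite /step_sum big_ord0.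
  by rewrite addn0; apply: filterS (semigroup0 jh0) => x /[apply] -> /=; rewrite subrr.
have nh0 : 0 <= n%:R * h by rewrite mulr_ge0.
rewrite (_ : step_sum h n.+1 f = (fun x => h * T (n%:R * h) f x + step_sum h n f x)); last first.
  by apply/funext => x; rewrite /step_sum big_ord_recr/= addrC.
have H1 := semigroup_lin h jh0 (semigroup_L2 nh0 Lf) (L2_step_sum n h0 Lf).
have := semigroupD jh0 nh0 Lf; rewrite -mulrDl -natrD => H2.
apply: filterS3 H1 H2 IH => x /(_ I) -> /(_ I) <- /(_ I) -> _ /=.
by rewrite addnS /step_sum [in RHS]big_ord_recr/= addrCA addrA.
Qed.

End semigroup_theory.

(** * The generator and its value on time integrals *)

Section generator.
Context {R : realType} {d : measure_display} {E : borelMetricType R d}.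
Variable m : {measure set E -> \bar R}.
Local Notation snorm := (seminorm (inner m)).
Local Notation LI := (L2_semi_inner m).
Implicit Types f g u v : E -> R.
Variable T : R -> (E -> R) -> (E -> R).
Hypothesis TS : L2_semigroup m T.
Local Notation ssum := (step_sum T).

Lemma sg_generatorP u v : L2 m u -> L2 m v ->
  sg_generator m T u v <->
  forall e : R, 0 < e -> exists2 delta : R, 0 < delta &
    forall t, 0 < t -> t < delta ->
      snorm ((T t u \- u) \- (fun x => t * v x)) <= t * e.
Proof.
move=> Lu Lv.
have LB t : 0 < t -> L2 m ((T t u \- u) \- (fun x => t * v x)).
  move=> t0; apply: (si_closedB LI); last exact: (si_closedZ LI).
  by apply: (si_closedB LI) => //; apply: (semigroup_L2 TS) => //; exact: ltW.
have quot t : 0 < t -> (fun x => t^-1 * (T t u x - u x) - v x) =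
    (fun x => t^-1 * ((T t u \- u) \- (fun x => t * v x)) x).
  by move=> t0; apply/funext => x /=; field; rewrite gt_eqF.
have near_pos (P : R -> Prop) : (forall t, 0 < t -> P t) -> \forall t \near 0^'+, P t.
  by move=> H; near=> t; apply: H.
have Lq : \forall t \near (0 : R)^'+, L2 m (fun x => t^-1 * (T t u x - u x) - v x).
  by apply: near_pos => t t0; rewrite quot//; apply: (si_closedZ LI); exact: LB.
have nq t : 0 < t -> snorm (fun x => t^-1 * (T t u x - u x) - v x) =
    t^-1 * snorm ((T t u \- u) \- (fun x => t * v x)).
  move=> t0; rewrite quot// (seminormZ LI _ (LB t t0)) ger0_norm//.
  by rewrite invr_ge0 ltW.
rewrite /sg_generator (L2_cvg0P _ Lq); split => H e e0.
  have [delta /= d0 Hd] := H e e0; exists delta => // t t0 td.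
  have := Hd t; rewrite /= sub0r normrN gtr0_norm// => /(_ td t0).
  by rewrite nq// mulrC ler_pdivrMr// mulrC.
have [delta d0 Hd] := H e e0; exists delta => //= t.
rewrite /= sub0r normrN => td t0; rewrite gtr0_norm// in td.
by rewrite nq// mulrC ler_pdivrMr// mulrC Hd.
Unshelve. all: end_near. Qed.

(** T_s commutes with T_t and does not increase the error of the expansion. *)
Lemma sg_generator_T s u v : 0 <= s -> L2 m u -> L2 m v ->
  sg_generator m T u v -> sg_generator m T (T s u) (T s v).
Proof.
move=> s0 Lu Lv /(sg_generatorP Lu Lv) H.
have [Lsu Lsv] := (semigroup_L2 TS s0 Lu, semigroup_L2 TS s0 Lv).
apply/(sg_generatorP Lsu Lsv) => e e0; have [delta d0 Hd] := H e e0.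
exists delta => // t t0 td; have t0' := ltW t0.
have Ltu := semigroup_L2 TS t0' Lu.
have LB : L2 m (T t u \- u) by exact: (si_closedB LI).
have Ltv : L2 m (fun x => t * v x) by exact: (si_closedZ LI).
apply: le_trans (Hd t t0 td).
apply: le_trans (semigroup_contr TS s0 (si_closedB LI LB Ltv)).
rewrite le_eqVlt; apply/orP; left; apply/eqP; apply: snorm_ae_eq.
- apply: (si_closedB LI); last exact: (si_closedZ LI).
  by apply: (si_closedB LI) => //; exact: (semigroup_L2 TS).
- by apply: (semigroup_L2 TS) => //; exact: (si_closedB LI).
have H1 := semigroupB TS s0 LB Ltv; have H2 := semigroupB TS s0 Ltu Lu.
have H3 := semigroupZ TS t s0 Lv.
have H4 := semigroupD TS s0 t0' Lu; have H5 := semigroupD TS t0' s0 Lu.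
rewrite addrC in H5.
have {H4 H5}H4 : T t (T s u) = T s (T t u) %[ae m].
  by apply: filterS2 H4 H5 => x /(_ I) -> /(_ I) ->.
have {H1 H2}H1 : T s ((T t u \- u) \- (fun x => t * v x)) =
    (T s (T t u) \- T s u) \- T s (fun x => t * v x) %[ae m].
  by apply: filterS2 H1 H2 => x /(_ I) -> /= /(_ I) ->.
by apply: filterS3 H1 H3 H4 => x /(_ I) -> /= /(_ I) -> /(_ I) ->.
Qed.

Lemma sg_generatorB u1 v1 u2 v2 : L2 m u1 -> L2 m v1 -> L2 m u2 -> L2 m v2 ->
  sg_generator m T u1 v1 -> sg_generator m T u2 v2 ->
  sg_generator m T (u1 \- u2) (v1 \- v2).
Proof.
move=> Lu1 Lv1 Lu2 Lv2 /(sg_generatorP Lu1 Lv1) H1 /(sg_generatorP Lu2 Lv2) H2.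
apply/(sg_generatorP (si_closedB LI Lu1 Lu2) (si_closedB LI Lv1 Lv2)) => e e0.
have e20 : 0 < e / 2 by rewrite divr_gt0.
have [d1 d10 Hd1] := H1 _ e20; have [d2 d20 Hd2] := H2 _ e20.
exists (Num.min d1 d2); first by rewrite lt_min d10.
move=> t t0; rewrite lt_min => /andP[td1 td2]; have t0' := ltW t0.
have LT1 := semigroup_L2 TS t0' Lu1; have LT2 := semigroup_L2 TS t0' Lu2.
have LA1 : L2 m ((T t u1 \- u1) \- (fun x => t * v1 x)).
  by apply: (si_closedB LI); [exact: (si_closedB LI)|exact: (si_closedZ LI)].
have LA2 : L2 m ((T t u2 \- u2) \- (fun x => t * v2 x)).
  by apply: (si_closedB LI); [exact: (si_closedB LI)|exact: (si_closedZ LI)].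
rewrite (snorm_ae_eq (f' := ((T t u1 \- u1) \- (fun x => t * v1 x)) \-
    ((T t u2 \- u2) \- (fun x => t * v2 x)))).
- have L0 := L2_0 m.
  apply: le_trans (seminorm_tri LI LA1 L0 LA2) _.
  rewrite [X in _ + X](seminorm_subC LI)//.
  have -> : (T t u1 \- u1) \- (fun x => t * v1 x) \- cst 0 = (T t u1 \- u1) \- (fun x => t * v1 x).
    by apply/funext => x /=; rewrite subr0.
  have -> : (T t u2 \- u2) \- (fun x => t * v2 x) \- cst 0 = (T t u2 \- u2) \- (fun x => t * v2 x).
    by apply/funext => x /=; rewrite subr0.
  by rewrite [e]splitr mulrDr lerD ?Hd1 ?Hd2.
- apply: (si_closedB LI); last by apply: (si_closedZ LI); exact: (si_closedB LI).
  apply: (si_closedB LI); last exact: (si_closedB LI).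
  by apply: (semigroup_L2 TS) => //; exact: (si_closedB LI).
- exact: (si_closedB LI).
- by apply: filterS (semigroupB TS t0' Lu1 Lu2) => x /(_ I) /= -> _; ring.
Qed.

(* With h = tau / n and j h <= t < (j + 1) h, applying T_{jh} - 1 to the Riemann
   sum of T_s f over [0, tau] or applying T_tau - 1 to the one over [0, jh]
   gives the same result. *)
Lemma L2_integral_generator f tau S : 0 < tau -> L2 m f ->
  L2_integral m (T^~ f) 0 tau S -> sg_generator m T S (T tau f \- f).
Proof.
move=> tau0 Lf IS; have LS := IS.1; have tau0' := ltW tau0.
have Ltau := semigroup_L2 TS tau0' Lf.
pose y := T tau f \- f.
have Ly : L2 m y by exact: (si_closedB LI).
apply/(sg_generatorP LS Ly) => e e0.
have [delta d0 Hd] := semigroup_cont0 TS Ly e0; exists delta => // t t0 td.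
have t0' := ltW t0.
apply/ler_addgt0Pr => eps eps0; have eps40 : 0 < eps / 4 by rewrite divr_gt0.
have [d1 d10 Hd1] := L2_integral_step_sum TS Lf tau0' IS eps40.
have [d2 d20 Hd2] := semigroup_unif_cont TS LS eps40.
pose Y := snorm y; have Y0 : 0 <= Y by exact: seminorm_ge0.
(* The step must be small for the Riemann sum ([d1]), for the continuity of T_t S in t ([d2]) and
   against the norm of [y]; [Y + 1] is positive even if [y] vanishes. *)
have [|n Hn] := @archi_div R tau (Num.min (Num.min d1 d2) (eps / 4 / (Y + 1))).
  rewrite !lt_min d10 d20/= divr_gt0//; lra.
pose h := tau / n.+1%:R.
have h0 : 0 < h by rewrite divr_gt0.
have h0' := ltW h0.
have /andP[/andP[hd1 hd2] hY] : (h < d1) && (h < d2) && (h < eps / 4 / (Y + 1)).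
  by have := Hn n (leqnn n); rewrite !lt_min.
have nh : n.+1%:R * h = tau by rewrite mulrC divfK.
(* [t] is rounded down to the grid point [j * h], less than [h] away, because T_(jh) is explicit on
   grid sums. *)
pose j := Num.truncn (t / h).
have /andP[jt tj] : j%:R * h <= t < j.+1%:R * h.
  rewrite -ler_pdivlMr// -ltr_pdivrMr//; apply: truncn_itv.
  by rewrite divr_ge0.
have jh0 : 0 <= j%:R * h by rewrite mulr_ge0.
have tjh : `|t - j%:R * h| < h.
  rewrite ger0_norm ?subr_ge0// ltrBlDl; apply: lt_le_trans tj _.
  by rewrite -natr1 mulrDl mul1r addrC.
pose Rn := ssum h n.+1 f.
have LRn : L2 m Rn by exact: (L2_step_sum TS).
pose G i := T ((n.+1 + i)%:R * h) f \- T (i%:R * h) f.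
have LG i : L2 m (G i) by apply: (si_closedB LI); apply: (semigroup_L2 TS) => //; rewrite mulr_ge0.
(* What survives cancellation in T_(jh) Rn - Rn: the [j] terms from time [tau] on, minus the first
   [j] terms. *)
pose W x := \sum_(i < j) h * G i x.
have LW : L2 m W.
  by apply: (si_closed_sum LI (F := fun i x => h * G i x)) => i _; apply: (si_closedZ LI).
have TRn : T (j%:R * h) Rn \- Rn = W %[ae m].
  apply: filterS (semigroup_step_sum TS j n.+1 h0' Lf) => x /(_ I) /= -> _.
  rewrite /W /Rn /step_sum addnC; under [RHS]eq_bigr do rewrite mulrBr.
  rewrite sumrB -!(big_mkord xpredT (fun i => h * T (i%:R * h) f x)).
  rewrite (@big_cat_nat _ _ _ n.+1 0 (n.+1 + j))//= ?leq_addr//.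
  rewrite -{2}[n.+1]add0n big_addn addKn big_mkord.
  rewrite [X in _ = X - _](eq_bigr (fun i : 'I_j => h * T ((i + n.+1)%:R * h) f x)).
    by rewrite !big_mkord; ring.
  by move=> i _; rewrite addnC.
have LTt : L2 m (T t S) by exact: (semigroup_L2 TS).
have LTj : L2 m (T (j%:R * h) S) by exact: (semigroup_L2 TS).
have LTR : L2 m (T (j%:R * h) Rn) by exact: (semigroup_L2 TS).
have Lty c : L2 m (fun x => c * y x) by exact: (si_closedZ LI).
have b1 : snorm (T t S \- T (j%:R * h) S) <= eps / 4.
  by apply: Hd2 => //; exact: lt_trans tjh hd2.
have b3 : snorm (Rn \- S) <= eps / 4 by apply/ltW/Hd1.
have b2 : snorm (T (j%:R * h) S \- T (j%:R * h) Rn) <= eps / 4.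
  by rewrite (le_trans (semigroup_dist TS jh0 LS LRn))// (seminorm_subC LI).
(* [G i] is T_(ih) y a.e. with i h <= t < delta, hence within [e] of [y]; the total weight of these
   terms is j h <= t. *)
have b4 : snorm (W \- (fun x => j%:R * h * y x)) <= t * e.
  apply: (@le_trans _ _ (j%:R * h * e)); last by rewrite ler_pM2r.
  apply: snorm_sum_near => // i ij.
  have ih0 : 0 <= i%:R * h by rewrite mulr_ge0.
  rewrite (snorm_ae_eq (f' := T (i%:R * h) y \- y)).
  - apply: Hd => //; apply: le_lt_trans td; apply: le_trans jt.
    by rewrite ler_pM2r// ler_nat ltnW.
  - exact: (si_closedB LI).
  - by apply: (si_closedB LI) => //; exact: (semigroup_L2 TS).
  - have H1 := semigroupB TS ih0 Ltau Lf.
    have := semigroupD TS ih0 tau0' Lf; rewrite -nh -mulrDl -natrD nh addnC => H2.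
    by apply: filterS2 H1 H2 => x /(_ I) /= -> /(_ I) H _; rewrite /G /= H.
have b5 : snorm ((fun x => j%:R * h * y x) \- (fun x => t * y x)) <= eps / 4.
  rewrite (_ : _ \- _ = (fun x => (j%:R * h - t) * y x)); last first.
    by apply/funext => x /=; rewrite mulrBl.
  rewrite (seminormZ LI)// distrC -/Y.
  apply: (@le_trans _ _ (h * Y)); first by rewrite ler_wpM2r// ltW.
  have hY' : h * (Y + 1) < eps / 4 by rewrite -ltr_pdivlMr//; lra.
  by rewrite (le_trans _ (ltW hY'))// ler_pM2l//; lra.
have L1 := si_closedB LI LTt LS.
have L2' := si_closedB LI LTj LS.
have L3 := si_closedB LI LTR LRn.
(* One quarter of [eps] pays for replacing t by j h in T_t S, two for replacing S by Rn, one for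
   replacing j h by t in front of y. *)
have -> : t * e + eps = eps / 4 + (eps / 4 + eps / 4 + (t * e + eps / 4)) by field.
apply: le_trans (seminorm_tri LI L1 L2' (Lty t)) _; apply: lerD.
  by rewrite (_ : _ \- _ \- _ = T t S \- T (j%:R * h) S)//; apply/funext => x /=; ring.
apply: le_trans (seminorm_tri LI L2' L3 (Lty t)) _; apply: lerD.
  apply: le_trans (lerD b2 b3); apply: le_trans (seminormD LI _ _).
  - by rewrite le_eqVlt; apply/orP; left; apply/eqP; congr seminorm; apply/funext => x /=; ring.
  - exact: (si_closedB LI).
  - exact: (si_closedB LI).
apply: le_trans (seminorm_tri LI L3 (Lty (j%:R * h)) (Lty t)) _; apply: lerD => //.
rewrite (snorm_ae_eq (f' := W \- (fun x => j%:R * h * y x)))//.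
- exact: (si_closedB LI).
- exact: (si_closedB LI).
- by apply: filterS TRn => x /(_ I) /= -> _.
Qed.

End generator.

(** * Positivity *)

Section positivity.
Context {R : realType} {d : measure_display} {E : borelMetricType R d}.
Variable m : {measure set E -> \bar R}.
Local Notation snorm := (seminorm (inner m)).
Local Notation LI := (L2_semi_inner m).
Implicit Types f g u v : E -> R.

Lemma L2_funrneg f : L2 m f -> L2 m f^\-.
Proof.
move=> Lf; apply: L2_dom (Lf) _; first by apply: measurable_funrneg; exact: L2_meas Lf.
move=> x; rewrite /funrneg maxEle; case: ifPn => [_|_]; first by rewrite normr0.
by rewrite normrN.
Qed.

Lemma snorm_funrneg f : L2 m f -> snorm f^\- <= snorm f.
Proof.
move=> Lf; apply: le_snorm => //; first exact: L2_funrneg.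
move=> x; rewrite /funrneg maxEle; case: ifPn => [_|_]; first by rewrite normr0.
by rewrite normrN.
Qed.

Lemma funrneg_lip f g : L2 m f -> L2 m g -> snorm (f^\- \- g^\-) <= snorm (f \- g).
Proof.
move=> Lf Lg; apply: le_snorm.
- by apply: (si_closedB LI); exact: L2_funrneg.
- exact: (si_closedB LI).
- move=> x /=; rewrite /funrneg !maxEle.
  by repeat case: ifPn; rewrite -?ltNge => *; rewrite ler_norml; apply/andP; split;
    have := ler_norm (f x - g x); have := ler_norm (- (f x - g x)); rewrite normrN; lra.
Qed.

Lemma snorm_funrneg_le f g : L2 m f -> L2 m g -> snorm f^\- <= snorm g^\- + snorm (f \- g).
Proof.
move=> Lf Lg; have [Lfn Lgn] := (L2_funrneg Lf, L2_funrneg Lg).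
by apply: le_trans (seminorm_leB LI Lfn Lgn) _; rewrite lerD2l funrneg_lip.
Qed.

Variable T : R -> (E -> R) -> (E -> R).
Hypothesis TS : L2_semigroup m T.
Hypothesis dissipative : forall u v, L2 m u -> L2 m v -> sg_generator m T u v ->
  0 <= inner m v u^\-.

(* |x^-| is the distance from x to the nonnegative cone, so that
   |y^-| <= |y - x^+| = |(y - x) - x^-|. *)
Lemma funrneg_step (x y v : E -> R) (h e C : R) : L2 m x -> L2 m y -> L2 m v ->
  0 <= h -> 0 <= e -> 0 <= inner m v x^\- -> snorm x <= C ->
  snorm v <= C -> snorm ((y \- x) \- (fun s => h * v s)) <= h * e ->
  snorm y^\- ^+ 2 <= snorm x^\- ^+ 2 + h * (h * (e + C) ^+ 2 + 2 * e * C).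
Proof.
move=> Lx Ly Lv h0 e0 vx0 xC vC yxv.
have Lxn := L2_funrneg Lx; have Lyn := L2_funrneg Ly.
have Lyx := si_closedB LI Ly Lx; have Lhv := si_closedZ LI h Lv.
have C0 : 0 <= C by apply: le_trans xC; exact: seminorm_ge0.
have H1 : snorm y^\- <= snorm ((y \- x) \- x^\-).
  apply: le_snorm => //; first exact: (si_closedB LI).
  move=> s /=; rewrite /funrneg !maxEle.
  by repeat case: ifPn; rewrite -?ltNge => *; rewrite ?normr0//;
    rewrite ler_norml; apply/andP; split;
    have := ler_norm (y s - x s - 0); have := ler_norm (- (y s - x s - 0));
    have := ler_norm (y s - x s - - x s); have := ler_norm (- (y s - x s - - x s));
    rewrite !normrN; lra.
have H2 : snorm y^\- ^+ 2 <= snorm ((y \- x) \- x^\-) ^+ 2.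
  by rewrite lerXn2r ?nnegrE ?seminorm_ge0.
apply: le_trans H2 _.
have Lz := si_closedB LI Lyx Lhv.
rewrite (seminormB_sq LI)//.
have yx : snorm (y \- x) <= h * (e + C).
  apply: le_trans (seminorm_leB LI Lyx Lhv) _.
  by rewrite (seminormZ LI)// ger0_norm// mulrDr addrC lerD// ler_wpM2l.
have yx2 : snorm (y \- x) ^+ 2 <= (h * (e + C)) ^+ 2.
  by rewrite lerXn2r ?nnegrE ?seminorm_ge0// mulr_ge0// addr_ge0.
(* Lower bound for the cross term of the square: y - x is h v up to an error of norm at most h e,
   and (v, x^-) >= 0. *)
have : - (h * e * C) <= inner m (y \- x) x^\-.
  rewrite (_ : y \- x = ((y \- x) \- (fun s => h * v s)) \+ (fun s => h * v s)).
    rewrite (si_addl LI)// (si_scalel LI)//.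
    have z1 : `|inner m ((y \- x) \- (fun s => h * v s)) x^\-| <= h * e * C.
      apply: le_trans (cauchy_schwarz LI Lz Lxn) _.
      by apply: ler_pM => //; [exact: seminorm_ge0|exact: seminorm_ge0|
        exact: le_trans (snorm_funrneg Lx) xC].
    have z2 : 0 <= h * inner m v x^\- by rewrite mulr_ge0.
    have := ler_norm (- inner m ((y \- x) \- (fun s => h * v s)) x^\-).
    by rewrite normrN; lra.
  by apply/funext => s /=; ring.
move: (inner m (y \- x) x^\-) => q Hq; rewrite exprMn in yx2.
have -> : h * (h * (e + C) ^+ 2 + 2 * e * C) = h ^+ 2 * (e + C) ^+ 2 + 2 * (h * e * C) by ring.
lra.
Qed.

(** An Euler scheme with steps of length h: each step raises the squared norm of the negative part
    by at most h (h K + 2 e C), so by t (h K + 2 e C) in all, which is made at most eps. The domain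
    of the generator is stable under the semigroup, so dissipativity applies at every step. *)
Lemma semigroup_funrneg_le t u v : 0 <= t -> L2 m u -> L2 m v -> sg_generator m T u v ->
  snorm (T t u)^\- <= snorm u^\-.
Proof.
move=> t0 Lu Lv guv.
have [C [uC vC]] : exists C, snorm u <= C /\ snorm v <= C.
  by exists (Num.max (snorm u) (snorm v)); rewrite !le_max !lexx orbT.
have C0 : 0 <= C by apply: le_trans uC; exact: seminorm_ge0.
rewrite -(@ler_pXn2r _ 2)// ?nnegrE ?seminorm_ge0//.
apply/ler_addgt0Pr => eps eps0.
(* Makes 2 t e C at most eps / 2. It is fixed before [K], which depends on it; the added 1s keep the
   denominator positive. *)
pose e := eps / 2 / ((t + 1) * (2 * C + 1)).
have tC0 : 0 < (t + 1) * (2 * C + 1) by rewrite mulr_gt0//; lra.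
have e0 : 0 < e by rewrite !divr_gt0.
have [delta d0 Hd] := (sg_generatorP TS Lu Lv).1 guv e e0.
pose K := (e + C) ^+ 2.
have K0 : 0 <= K by rewrite sqr_ge0.
have tK0 : 0 < (t + 1) * (K + 1) by rewrite mulr_gt0//; lra.
(* The second bound on the step makes t h K at most eps / 2. *)
have [|n Hn] := @archi_div R t (Num.min delta (eps / 2 / ((t + 1) * (K + 1)))).
  by rewrite lt_min d0 !divr_gt0.
pose h := t / n.+1%:R.
have h0 : 0 <= h by rewrite divr_ge0.
have /andP[hd hK] : (h < delta) && (h < eps / 2 / ((t + 1) * (K + 1))).
  by have := Hn n (leqnn n); rewrite lt_min.
have nh : n.+1%:R * h = t by rewrite mulrC divfK.
have step i : snorm (T (i%:R * h) u)^\- ^+ 2 <=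
    snorm u^\- ^+ 2 + i%:R * (h * (h * K + 2 * e * C)).
  elim: i => [|i IH].
    rewrite !mul0r addr0 (snorm_ae_eq (f' := u^\-))//.
    - by apply: L2_funrneg; apply: (semigroup_L2 TS).
    - exact: L2_funrneg.
    - by apply: filterS (sg_0 TS Lu) => x /(_ I) /= H _; rewrite /funrneg H.
  have ih0 : 0 <= i%:R * h by rewrite mulr_ge0.
  have Lx := semigroup_L2 TS ih0 Lu; have Ly := semigroup_L2 TS h0 Lx.
  have Lw := semigroup_L2 TS ih0 Lv.
  have gi := sg_generator_T TS ih0 Lu Lv guv.
  have LTi : L2 m (T (i.+1%:R * h) u) by apply: (semigroup_L2 TS) => //; rewrite mulr_ge0.
  rewrite (snorm_ae_eq (f' := (T h (T (i%:R * h) u))^\-)); last 3 first.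
  - exact: L2_funrneg.
  - exact: L2_funrneg.
  - have := semigroupD TS h0 ih0 Lu.
    rewrite (_ : h + i%:R * h = i.+1%:R * h); last by rewrite -nat1r; ring.
    by apply: filterS => x /(_ I) H _; rewrite /funrneg H.
  apply: (@le_trans _ _ (snorm (T (i%:R * h) u)^\- ^+ 2 + h * (h * K + 2 * e * C))); last first.
    by rewrite -[i.+1%:R]natr1 [(i%:R + 1) * _]mulrDl mul1r addrA lerD2r.
  apply: (funrneg_step Lx Ly Lw h0 (ltW e0)).
  - exact: dissipative Lx Lw gi.
  - exact: le_trans (semigroup_contr TS ih0 Lu) uC.
  - exact: le_trans (semigroup_contr TS ih0 Lv) vC.
  - have Lz := si_closedB LI (si_closedB LI Ly Lx) (si_closedZ LI h Lw).
    (* The expansion holds at positive times only, and h = 0 occurs when t = 0. *)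
    have [hh|hn0] := eqVneq h 0.
      rewrite (snorm_ae_eq (f' := cst 0))//; last 2 first.
      + exact: L2_0.
      + have : T h (T (i%:R * h) u) = T (i%:R * h) u %[ae m].
          by rewrite [in T h]hh; exact: (sg_0 TS).
        by apply: filterS => x /(_ I) /= -> _; rewrite subrr hh mul0r subrr.
      by rewrite /seminorm (si_0l LI (L2_0 m)) sqrtr0 mulr_ge0// ltW.
    have hp : 0 < h by rewrite lt_neqAle eq_sym hn0.
    have LB := si_closedB LI (si_closedB LI (semigroup_L2 TS h0 Lu) Lu) (si_closedZ LI h Lv).
    (* The expansion error at T_(ih) u is T_(ih) applied to the error at u, so one bound serves all
       steps. *)
    apply: le_trans (Hd h hp hd); apply: le_trans (semigroup_contr TS ih0 LB).
    rewrite le_eqVlt; apply/orP; left; apply/eqP; apply: snorm_ae_eq.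
    - by apply: (si_closedB LI); [exact: (si_closedB LI)|exact: (si_closedZ LI)].
    - exact: (semigroup_L2 TS).
    - have H1 := semigroupB TS ih0 (si_closedB LI (semigroup_L2 TS h0 Lu) Lu) (si_closedZ LI h Lv).
      have H2 := semigroupB TS ih0 (semigroup_L2 TS h0 Lu) Lu.
      have H3 := semigroupZ TS h ih0 Lv.
      have H4 := semigroupD TS ih0 h0 Lu; have H5 := semigroupD TS h0 ih0 Lu.
      rewrite addrC in H5.
      have {H4 H5}H4 : T h (T (i%:R * h) u) = T (i%:R * h) (T h u) %[ae m].
        by apply: filterS2 H4 H5 => x /(_ I) -> /(_ I) ->.
      have {H1 H2}H1 : T (i%:R * h) ((T h u \- u) \- (fun x => h * v x)) =
          (T (i%:R * h) (T h u) \- T (i%:R * h) u) \- T (i%:R * h) (fun x => h * v x) %[ae m].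
        by apply: filterS2 H1 H2 => x /(_ I) -> /= /(_ I) ->.
      by apply: filterS3 H1 H3 H4 => x /(_ I) -> /= /(_ I) -> /(_ I) ->.
have := step n.+1; rewrite nh; move/le_trans; apply; rewrite lerD2l mulrA nh.
have b1 : h * K * t <= eps / 2.
  have : h * ((t + 1) * (K + 1)) < eps / 2 by rewrite -ltr_pdivlMr.
  have : 0 <= h * t by rewrite mulr_ge0.
  have : 0 <= h * K by rewrite mulr_ge0.
  have -> : h * ((t + 1) * (K + 1)) = h * K * t + h * t + h * K + h by ring.
  lra.
have b2 : t * (2 * e * C) <= eps / 2.
  have : e * ((t + 1) * (2 * C + 1)) = eps / 2 by rewrite /e divfK// gt_eqF.
  have : 0 <= e * t by rewrite mulr_ge0// ltW.
  have : 0 <= e * C by rewrite mulr_ge0// ltW.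
  have -> : e * ((t + 1) * (2 * C + 1)) = t * (2 * e * C) + 2 * (e * C) + e * t + e by ring.
  lra.
lra.
Qed.

(** [g] need not be in the domain of the generator, but the integral S of T_s g over [0, tau] is,
    and it is within tau eps / 3 of tau g. As tau g has no negative part, this bounds |S^-| and
    hence |(T_t S)^-|; returning to tau g costs as much again, and division by tau leaves 2 eps /
    3. *)
Lemma semigroup_ge0 t g : 0 <= t -> L2 m g -> {ae m, forall x, 0 <= g x} ->
  {ae m, forall x, 0 <= T t g x}.
Proof.
move=> t0 Lg g0.
have LTg := semigroup_L2 TS t0 Lg.
suff H : snorm (T t g)^\- = 0.
  have := snorm_eq0 (L2_funrneg LTg) H; apply: filterS => x /(_ I) /=.
  rewrite /funrneg maxEle; case: ifPn => [|_ /eqP]; first by rewrite oppr_le0.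
  by rewrite oppr_eq0 => /eqP ->.
apply/eqP; rewrite eq_le seminorm_ge0 andbT; apply/ler_addgt0Pr => eps eps0; rewrite add0r.
have e0 : 0 < eps / 3 by rewrite divr_gt0.
have [delta d0 Hd] := semigroup_cont0 TS Lg e0.
pose tau := delta / 2.
have tau0 : 0 < tau by rewrite divr_gt0.
have tau0' := ltW tau0.
have [S IS] := semigroup_integral_exists TS tau0' Lg.
have LS := IS.1.
have Ltg : L2 m (fun x => tau * g x) by exact: (si_closedZ LI).
have near : snorm (S \- (fun x => tau * g x)) <= tau * (eps / 3).
  apply/ler_addgt0Pr => r r0.
  have [d1 d10 Hd1] := L2_integral_step_sum TS Lg tau0' IS r0.
  have [n Hn] := @archi_div R tau d1 d10.
  pose h := tau / n.+1%:R.
  have h0 : 0 <= h by rewrite divr_ge0.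
  have nh : n.+1%:R * h = tau by rewrite mulrC divfK.
  have LU := L2_step_sum TS n.+1 h0 Lg.
  apply: le_trans (seminorm_tri LI LS LU Ltg) _; rewrite addrC; apply: lerD; last first.
    by rewrite (seminorm_subC LI)//; apply/ltW/Hd1 => //; exact: Hn n (leqnn n).
  rewrite -nh; apply: (snorm_sum_near (G := fun i => T (i%:R * h) g)) => //.
    by move=> i _; apply: (semigroup_L2 TS) => //; rewrite mulr_ge0.
  move=> i ni; apply: Hd; first by rewrite mulr_ge0.
  apply: (@le_lt_trans _ _ tau); last by rewrite /tau; lra.
  by rewrite -nh ler_wpM2r// ler_nat ltnW.
have Lgen : L2 m (T tau g \- g) by apply: (si_closedB LI) => //; exact: (semigroup_L2 TS).
have gS := L2_integral_generator TS tau0 Lg IS.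
have LTS := semigroup_L2 TS t0 LS; have LTtg := semigroup_L2 TS t0 Ltg.
have n1 : snorm S^\- <= tau * (eps / 3).
  apply: le_trans (snorm_funrneg_le LS Ltg) _.
  rewrite (snorm_ae_eq (f' := cst 0)).
  - by rewrite {1}/seminorm (si_0l LI) ?sqrtr0 ?add0r//; exact: L2_0.
  - exact: L2_funrneg.
  - exact: L2_0.
  - apply: filterS g0 => x gx _ /=; rewrite /funrneg; apply/max_idPr.
    by rewrite oppr_le0 mulr_ge0.
have n2 := le_trans (semigroup_funrneg_le t0 LS Lgen gS) n1.
have n3 : snorm (T t (fun x => tau * g x))^\- <= tau * (eps / 3) + tau * (eps / 3).
  apply: le_trans (snorm_funrneg_le LTtg LTS) _; apply: lerD => //.
  apply: le_trans (semigroup_dist TS t0 Ltg LS) _.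
  by rewrite (seminorm_subC LI).
have n4 : snorm (T t (fun x => tau * g x))^\- = tau * snorm (T t g)^\-.
  rewrite -[tau in RHS]ger0_norm// -(seminormZ LI); last exact: L2_funrneg.
  apply: snorm_ae_eq; [exact: L2_funrneg|apply: (si_closedZ LI); exact: L2_funrneg|].
  apply: filterS (semigroupZ TS tau t0 Lg) => x /(_ I) H _.
  by rewrite /funrneg H -mulrN maxr_pMr ?mulr0.
rewrite n4 -mulrDr ler_pM2l// in n3.
by apply: le_trans n3 _; lra.
Qed.

End positivity.

(** * The closure of a closable form *)

Section form_closure_theory.
Context {R : realType} {d : measure_display} {E : borelMetricType R d}.
Variable m : {measure set E -> \bar R}.
Variable a : L2form E R.
Local Notation snorm := (seminorm (inner m)).
Local Notation LI := (L2_semi_inner m).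
Local Notation anorm := (seminorm (fval a)).
Implicit Types u v : E -> R.
Hypothesis aI : semi_inner (fdom a) (fval a).
Hypothesis aL2 : fdom a `<=` L2 m.
Hypothesis aC : closable m a.

Lemma form_cauchyP us : (forall n, fdom a (us n)) ->
  form_cauchy a us <->
  forall e : R, 0 < e -> exists N, forall n k, (N <= n)%N -> (N <= k)%N ->
    anorm (us n \- us k) < e.
Proof.
move=> Dus; have DB n k : fdom a (us n \- us k) by exact: (si_closedB aI).
split => [[_ H] e e0|H].
  have [N HN] := H _ (exprn_gt0 2 e0); exists N => n k Nn Nk.
  rewrite -(@ltr_pXn2r _ 2) ?nnegrE ?seminorm_ge0 ?ltW//.
  by rewrite (seminorm_sq aI)//; exact: HN.
split=> // e e0; have [|N HN] := H (Num.sqrt e); first by rewrite sqrtr_gt0.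
exists N => n k Nn Nk; rewrite /energy -(seminorm_sq aI)//.
rewrite -[e]sqr_sqrtr ?ltW// ltr_pXn2r ?nnegrE ?seminorm_ge0 ?sqrtr_ge0//.
exact: HN.
Qed.

Lemma form_cauchy_bounded us : form_cauchy a us ->
  exists N (C : R), 0 < C /\ forall n, (N <= n)%N -> anorm (us n) <= C.
Proof.
move=> cus; have Dus := cus.1.
have [N HN] := (form_cauchyP Dus).1 cus 1 ltr01.
exists N, (anorm (us N) + 1); split.
  by rewrite ltr_wpDl// seminorm_ge0.
move=> n Nn; apply: le_trans (seminorm_leB aI (Dus n) (Dus N)) _.
by rewrite lerD2l ltW// HN.
Qed.

Lemma form_cauchyB us vs : form_cauchy a us -> form_cauchy a vs ->
  form_cauchy a (fun n => us n \- vs n).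
Proof.
move=> cus cvs; have [Dus Dvs] := (cus.1, cvs.1).
have DB n : fdom a (us n \- vs n) by exact: (si_closedB aI).
apply/(form_cauchyP DB) => e e0; have e20 : 0 < e / 2 by rewrite divr_gt0.
have [N HN] := (form_cauchyP Dus).1 cus _ e20.
have [N' HN'] := (form_cauchyP Dvs).1 cvs _ e20.
exists (maxn N N') => n k; rewrite !geq_max => /andP[Nn N'n] /andP[Nk N'k].
rewrite (_ : _ \- _ = (us n \- us k) \+ (vs k \- vs n)); last first.
  by apply/funext => x /=; ring.
have D1 := si_closedB aI (Dus n) (Dus k); have D2 := si_closedB aI (Dvs k) (Dvs n).
apply: le_lt_trans (seminormD aI D1 D2) _.
by rewrite [e]splitr ltrD ?HN ?HN'.
Qed.

Lemma L2_cvgP us u : (forall n, L2 m (us n)) -> L2 m u ->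
  L2_cvg m us u <-> forall e : R, 0 < e -> exists N, forall n, (N <= n)%N ->
    snorm (us n \- u) <= e.
Proof.
move=> Lus Lu; have LB : \forall n \near \oo, L2 m (us n \- u).
  by apply: nearW => n; exact: (si_closedB LI).
rewrite /L2_cvg (L2_cvg0P _ LB); split => H e e0.
  by have [N _ HN] := H e e0; exists N.
by have [N HN] := H e e0; exists N.
Qed.

(** The difference of the two sequences is Cauchy for the form and tends to 0 in L^2, which is the
    situation of closability. *)
Lemma closure_approx_null us vs u : L2 m u ->
  closure_approx m a u us -> closure_approx m a u vs ->
  forall e : R, 0 < e -> exists N, forall n, (N <= n)%N -> anorm (us n \- vs n) < e.
Proof.
move=> Lu [cus us_u] [cvs vs_u] e e0; have [Dus Dvs] := (cus.1, cvs.1).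
have DB n : fdom a (us n \- vs n) by exact: (si_closedB aI).
have L0 := L2_0 m.
have LB n : L2 m (us n \- vs n) by exact: aL2.
have [Lus Lvs] : (forall n, L2 m (us n)) /\ (forall n, L2 m (vs n)).
  by split => n; exact: aL2.
have c0 : L2_cvg m (fun n => us n \- vs n) (cst 0).
  apply/L2_cvgP => // r r0; have r20 : 0 < r / 2 by rewrite divr_gt0.
  have [N HN] := (L2_cvgP Lus Lu).1 us_u _ r20.
  have [N' HN'] := (L2_cvgP Lvs Lu).1 vs_u _ r20.
  exists (maxn N N') => n; rewrite !geq_max => /andP[Nn N'n].
  rewrite (_ : _ \- _ = us n \- vs n); last by apply/funext => x /=; rewrite subr0.
  apply: le_trans (seminorm_tri LI (Lus n) Lu (Lvs n)) _.
  by rewrite [r]splitr lerD ?HN// (seminorm_subC LI)// HN'.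
have := aC (form_cauchyB cus cvs) c0.
move/cvgr0Pnorm_lt => /(_ _ (exprn_gt0 2 e0)) [N _ HN].
exists N => n Nn; have := HN n Nn.
rewrite ger0_norm ?(si_ge0 aI)// /energy -(seminorm_sq aI)//.
by rewrite ltr_pXn2r ?nnegrE ?seminorm_ge0 ?ltW.
Qed.

Lemma fval_closeness u u' v v' : fdom a u -> fdom a u' -> fdom a v -> fdom a v' ->
  `|fval a u v - fval a u' v'| <=
  anorm (u \- u') * anorm v + anorm u' * anorm (v \- v').
Proof.
move=> Du Du' Dv Dv'.
have -> : fval a u v - fval a u' v' = fval a (u \- u') v + fval a u' (v \- v').
  by rewrite (si_subl aI)// (si_subr aI)//; ring.
apply: le_trans (ler_normD _ _) _; apply: lerD; apply: (cauchy_schwarz aI) => //;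
  exact: (si_closedB aI).
Qed.

Lemma closure_fval_cvg us vs : form_cauchy a us -> form_cauchy a vs ->
  cvgn (fun n => fval a (us n) (vs n)).
Proof.
move=> cus cvs; have [Dus Dvs] := (cus.1, cvs.1).
have [N1 [C [C0 HC]]] := form_cauchy_bounded cus.
have [N2 [C' [C0' HC']]] := form_cauchy_bounded cvs.
apply/cauchy_cvgP; apply: cauchy_exP => e e0.
have r0 : 0 < e / (C + C' + 1) by rewrite divr_gt0//; lra.
have [N3 HN3] := (form_cauchyP Dus).1 cus _ r0.
have [N4 HN4] := (form_cauchyP Dvs).1 cvs _ r0.
pose N := maxn (maxn N1 N2) (maxn N3 N4).
exists (fval a (us N) (vs N)); exists N => // n /= Nn.
have : (N <= N)%N by []; have := Nn; rewrite {1 3}/N !geq_max.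
move=> /andP[/andP[? ?] /andP[? ?]] /andP[/andP[? ?] /andP[? ?]].
rewrite /ball/=.
apply: le_lt_trans (fval_closeness (Dus _) (Dus n) (Dvs _) (Dvs n)) _.
pose r := e / (C + C' + 1).
apply: (@le_lt_trans _ _ (r * C' + C * r)).
  apply: lerD; apply: ler_pM; rewrite ?seminorm_ge0//; [exact: ltW (HN3 _ _ _ _)|
    exact: HC'|exact: HC|exact: ltW (HN4 _ _ _ _)].
have : r * (C + C' + 1) = e by rewrite /r divfK// gt_eqF//; lra.
have -> : r * (C + C' + 1) = r * C' + C * r + r by ring.
by have := r0; rewrite -/r; lra.
Qed.

(** The value picked by [xget] comes with approximating sequences of its own; these differ from the
    given ones by sequences of vanishing energy, so the limits agree. *)
Lemma closure_fval u v us vs : L2 m u -> L2 m v ->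
  closure_approx m a u us -> closure_approx m a v vs ->
  fval a (us n) (vs n) @[n --> \oo] --> fval (form_closure m a) u v.
Proof.
move=> Lu Lv us_u vs_v.
have /= [us' [vs' [us'_u vs'_v us'vs']]] : [set r | exists us vs,
    [/\ closure_approx m a u us, closure_approx m a v vs &
        fval a (us n) (vs n) @[n --> \oo] --> r]] (fval (form_closure m a) u v).
  apply: xgetPex; exists (limn (fun n => fval a (us n) (vs n))), us, vs.
  by split => //; apply: closure_fval_cvg; [exact: us_u.1|exact: vs_v.1].
apply: (cvg_sub0 _ us'vs').
have [Dus Dvs] := (us_u.1.1, vs_v.1.1).
have [Dus' Dvs'] := (us'_u.1.1, vs'_v.1.1).
have [N1 [C [C0 HC]]] := form_cauchy_bounded us'_u.1.
have [N2 [C' [C0' HC']]] := form_cauchy_bounded vs_v.1.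
apply/cvgr0Pnorm_lt => e e0.
have r0 : 0 < e / (C + C' + 1) by rewrite divr_gt0//; lra.
have [N3 HN3] := closure_approx_null Lu us_u us'_u r0.
have [N4 HN4] := closure_approx_null Lv vs_v vs'_v r0.
exists (maxn (maxn N1 N2) (maxn N3 N4)) => // n /=.
rewrite !geq_max => /andP[/andP[? ?] /andP[? ?]].
apply: le_lt_trans (fval_closeness (Dus n) (Dus' n) (Dvs n) (Dvs' n)) _.
pose r := e / (C + C' + 1).
apply: (@le_lt_trans _ _ (r * C' + C * r)).
  apply: lerD; apply: ler_pM; rewrite ?seminorm_ge0//; [exact: ltW (HN3 _ _)|
    exact: HC'|exact: HC|exact: ltW (HN4 _ _)].
have : r * (C + C' + 1) = e by rewrite /r divfK// gt_eqF//; lra.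
have -> : r * (C + C' + 1) = r * C' + C * r + r by ring.
by have := r0; rewrite -/r; lra.
Qed.

Lemma closure_approx_cst u : fdom a u -> closure_approx m a u (fun=> u).
Proof.
move=> Du; have Lu := aL2 Du; split; first split=> // e e0.
  exists 0%N => n k _ _; rewrite /energy.
  rewrite (_ : u \- u = cst 0) ?(si_0l aI)//; first exact: (si_0 aI).
  by apply/funext => x /=; rewrite subrr.
apply/L2_cvgP => // e e0; exists 0%N => n _.
rewrite (_ : u \- u = cst 0); last by apply/funext => x /=; rewrite subrr.
by rewrite /seminorm (si_0l LI (L2_0 m)) sqrtr0 ltW.
Qed.

Hypothesis aPN : forall u, fdom a u ->
  [/\ fdom a u^\+, fdom a u^\- & fval a u^\+ u^\- <= 0].

Lemma fval_funrneg_le0 u : fdom a u -> fval a u u^\- <= 0.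
Proof.
move=> Du; have [Dp Dn pn] := aPN Du.
rewrite -[X in fval a X _]funrposBneg [X in fval a X _](_ : _ = u^\+ \- u^\-)//.
by rewrite (si_subl aI)// subr_le0 (le_trans pn)// (si_ge0 aI).
Qed.

(** From a (u) = a (u^+) - 2 a (u^+, u^-) + a (u^-). It keeps the energies of the negative parts
    bounded along a Cauchy sequence. *)
Lemma anorm_funrneg u : fdom a u -> anorm u^\- <= anorm u.
Proof.
move=> Du; have [Dp Dn pn] := aPN Du; apply: ler_wsqrtr.
rewrite -[in leRHS](funrposBneg u) (_ : u^\+ - u^\- = u^\+ \- u^\-)//.
have Dpn := si_closedB aI Dp Dn.
rewrite (si_subl aI)// !(si_subr aI)// (si_sym aI Dn)//.
have := si_ge0 aI Dp; lra.
Qed.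

(** The form is tested against u_k^-, where the u_k are core functions approximating u: these lie in
    the core and tend to u^- in L^2, so (v, u^-) is the limit of the (v, u_k^-). *)
Lemma closure_dissipative u v : L2 m v -> fdom (form_closure m a) u ->
  (forall w, fdom (form_closure m a) w ->
     fval (form_closure m a) u w = - inner m v w) ->
  0 <= inner m v u^\-.
Proof.
move=> Lv [Lu [us us_u]] Huv; have Dus := us_u.1.1.
have Lus n : L2 m (us n) by exact: aL2.
have Dn n : fdom a (us n)^\- by have [] := aPN (Dus n).
have Lun := L2_funrneg Lu.
have Lusn n : L2 m (us n)^\- by exact: aL2.
have [N1 [C [C0 HC]]] := form_cauchy_bounded us_u.1.
rewrite -oppr_le0; apply/ler_addgt0Pr => e e0; rewrite add0r.
have r0 : 0 < e / 2 / (C + 1) by rewrite !divr_gt0//; lra.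
have s0 : 0 < e / 2 / (snorm v + 1).
  by rewrite !divr_gt0//; have := seminorm_ge0 (inner m) v; lra.
have [N2 HN2] := (form_cauchyP Dus).1 us_u.1 _ r0.
have [N3 HN3] := (L2_cvgP Lus Lu).1 us_u.2 _ s0.
pose k := maxn N1 (maxn N2 N3).
have : (k <= k)%N by []; rewrite {1}/k !geq_max => /and3P[k1 k2 k3].
have h1 : - inner m v (us k)^\- <= e / 2.
  have Dk : fdom (form_closure m a) (us k)^\-.
    by split => //; exists (fun=> (us k)^\-); exact: closure_approx_cst.
  rewrite -Huv//.
  have cv := closure_fval Lu (Lusn k) us_u (closure_approx_cst (Dn k)).
  rewrite -(cvg_lim _ cv)//; apply: limr_le; first by apply/cvg_ex; eexists; exact: cv.
  exists k => // n /= kn.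
  have N2n : (N2 <= n)%N by exact: leq_trans kn.
  (* The part with u_k is nonpositive; the part with u_n - u_k is small by Cauchy-Schwarz, the
     energy of u_k^- being bounded. *)
  rewrite (_ : us n = (us n \- us k) \+ us k); last by apply/funext => x /=; ring.
  rewrite (si_addl aI)//; last exact: (si_closedB aI).
  have b1 := fval_funrneg_le0 (Dus k).
  have b2 := cauchy_schwarz aI (si_closedB aI (Dus n) (Dus k)) (Dn k).
  have b3 : anorm (us n \- us k) * anorm (us k)^\- <= e / 2 / (C + 1) * C.
    apply: ler_pM; rewrite ?seminorm_ge0//; first exact: ltW (HN2 _ _ _ _).
    exact: le_trans (anorm_funrneg (Dus k)) (HC k k1).
  have b4 : e / 2 / (C + 1) * C <= e / 2.
    by rewrite mulrAC ler_pdivrMr ?ler_wpM2l//; lra.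
  have := ler_norm (fval a (us n \- us k) (us k)^\-); lra.
have h2 : `|inner m v (u^\- \- (us k)^\-)| <= e / 2.
  apply: le_trans (cauchy_schwarz LI Lv (si_closedB LI Lun (Lusn k))) _.
  have : snorm (u^\- \- (us k)^\-) <= e / 2 / (snorm v + 1).
    apply: le_trans (funrneg_lip Lu (Lus k)) _.
    by rewrite (seminorm_subC LI)// HN3.
  have := seminorm_ge0 (inner m) v.
  have := seminorm_ge0 (inner m) (u^\- \- (us k)^\-).
  move: (snorm v) (snorm _) => V z z0 V0.
  rewrite ler_pdivlMr; last by lra.
  by rewrite mulrDr mulr1 mulrC; lra.
rewrite (si_subr LI) // in h2.
have := ler_norm (- (inner m v u^\- - inner m v (us k)^\-)); rewrite normrN.
lra.
Qed.

End form_closure_theory.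

(** * The core of the Schroedinger form *)

Section core.
Context {R : realType} {d : measure_display} {E : borelMetricType R d}.
Implicit Types (u v : E -> R).

Lemma continuous_borel u : continuous u -> measurable_fun setT u.
Proof.
move=> /continuousP cu; apply: (measurability _ (RGenOpens.measurableE R)).
move=> _ [_ [a [b ->] <-]]; rewrite setTI borelE; apply: sub_sigma_algebra.
exact/cu/interval_open.
Qed.

Lemma C0_bounded u : C0 u -> exists2 M : R, 0 < M & forall x, `|u x| <= M.
Proof.
move=> [cu Ku]; have := continuous_compact (continuous_subspaceT cu) Ku.
move=> /compact_bounded [M [Mr HM]].
exists (Num.max M 0 + 1); first by rewrite ltr_wpDl// le_max lexx orbT.
move=> x; have [->|ux] := eqVneq (u x) 0.
  by rewrite normr0 ltW// ltr_wpDl// le_max lexx orbT.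
apply: (HM (Num.max M 0 + 1)).
  by rewrite ltr_pwDr// le_max lexx.
by exists x => //; apply: subset_closure.
Qed.

Lemma C0_sub u v : C0 v -> continuous u -> (forall x, v x = 0 -> u x = 0) -> C0 u.
Proof.
move=> [cv Kv] cu uv; split=> //; apply: subclosed_compact Kv _.
  exact: closed_closure.
by apply: closure_subset => x /=; apply: contra_neq; exact: uv.
Qed.

Lemma C0_lin (c : R) u v : C0 u -> C0 v -> C0 (fun x => c * u x + v x).
Proof.
move=> [cu Ku] [cv Kv]; split.
  move=> x; apply: cvgD; last exact: cv.
  by apply: cvgMr; exact: cu.
apply: subclosed_compact (compactU Ku Kv) _; first exact: closed_closure.
rewrite -closureU; apply: closure_subset => x /= H.
have [u0|?] := eqVneq (u x) 0; last by left.
by right; apply: contra_neq H => v0; rewrite u0 v0 mulr0 addr0.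
Qed.

Lemma C0_0 : C0 (cst 0 : E -> R).
Proof.
split; first by move=> x; exact: cvg_cst.
rewrite (_ : [set x | _] = set0) ?closure0; first exact: compact0.
by rewrite -subset0 => x /=; rewrite eqxx.
Qed.

Lemma continuous_funrpos u : continuous u -> continuous u^\+.
Proof.
move=> cu; rewrite (_ : u^\+ = (fun x => 2^-1 * (u x + `|u x|))).
  move=> x; apply: cvgMr; apply: cvgD; first exact: cu.
  by apply: cvg_norm; exact: cu.
apply/funext => x; rewrite /funrpos maxEle; case: ifPn => ux.
  by rewrite ler0_norm// subrr mulr0.
by rewrite gtr0_norm ?ltNge//; field.
Qed.

Lemma continuous_funrneg u : continuous u -> continuous u^\-.
Proof.
move=> cu; rewrite -funrposN; apply: continuous_funrpos => x.
by apply: cvgN; exact: cu.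
Qed.

Lemma C0_funrpos u : C0 u -> C0 u^\+.
Proof.
move=> Cu; apply: C0_sub (Cu) _ _; first exact/continuous_funrpos/Cu.1.
by move=> x ux; rewrite /funrpos ux maxxx.
Qed.

Lemma C0_funrneg u : C0 u -> C0 u^\-.
Proof.
move=> Cu; apply: C0_sub (Cu) _ _; first exact/continuous_funrneg/Cu.1.
by move=> x ux; rewrite /funrneg ux oppr0 maxxx.
Qed.

(** A Radon measure is finite on the compact support, where u is bounded. This makes the integral of
    u v against mu bilinear on the core. *)
Lemma C0_L2 (mu : {measure set E -> \bar R}) u : radon mu -> C0 u -> L2 mu u.
Proof.
move=> rmu Cu; have [M M0 HM] := C0_bounded Cu; have [cu Ku] := Cu.
have mu_u := continuous_borel cu.
set K := closure _ in Ku.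
have mK : measurable K.
  rewrite borelE -[K]setCK; apply: sigma_algebraC.
  by apply: sub_sigma_algebra; apply: closed_openC; exact: closed_closure.
apply: L2I => //.
apply: (@le_lt_trans _ _ (\int[mu]_(x in K) (cst (M ^+ 2)%:E x))%E); last first.
  rewrite integral_cst// lte_mul_pinfty ?lee_fin ?sqr_ge0//.
  exact: rmu.1.
rewrite [leRHS]integral_mkcond; apply: ge0_le_integral => //.
- by move=> x _; rewrite lee_fin sqr_ge0.
- by apply/measurable_EFinP; exact: measurable_funX.
- by apply/(measurable_restrictT _ mK).1; exact: measurable_cst.
- move=> x _; rewrite patchE; case: ifPn => [_|].
    by rewrite lee_fin -(real_normK (num_real (u x))) lerXn2r ?nnegrE// ltW.
  have [->|ux] := eqVneq (u x) 0; first by rewrite expr0n.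
  by rewrite notin_setE; case; exact: subset_closure.
Qed.

Variable m : {measure set E -> \bar R}.
Variable a : L2form E R.
Hypothesis aD : dirichlet_form m a.

Lemma dirichlet_semi_inner : semi_inner (fdom a) (fval a).
Proof.
split; [exact: df_zero aD|exact: df_lin aD|exact: df_val_lin aD|exact: df_sym aD|
  exact: df_ge0 aD].
Qed.
Local Notation aI := dirichlet_semi_inner.

(** If |u| <= M, truncating u / M at 1 has no effect, so u^+ is M times the unit contraction of u /
    M. *)
Lemma dirichlet_funrpos u : fdom a u -> C0 u ->
  fdom a u^\+ /\ energy a u^\+ <= energy a u.
Proof.
move=> Du Cu; have [M M0 HM] := C0_bounded Cu.
have MV0 : M^-1 != 0 by rewrite invr_eq0 gt_eqF.
have [Dw Ew] := df_markov aD (si_closedZ aI M^-1 Du).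
have up : u^\+ = (fun x => M * Num.min (Num.max (M^-1 * u x) 0) 1).
  apply/funext => x; rewrite /funrpos minr_pMr ?ltW// maxr_pMr ?ltW//.
  rewrite mulr0 mulr1 mulrA mulfV ?gt_eqF// mul1r.
  apply/esym/min_idPl; rewrite ge_max (ltW M0) andbT.
  exact: le_trans (ler_norm _) (HM x).
split; first by rewrite up; exact: (si_closedZ aI).
rewrite up /energy (si_scalel aI) ?(si_scaler aI)//; last exact: (si_closedZ aI).
move: Ew; rewrite /energy (si_scalel aI) ?(si_scaler aI)//; last exact: (si_closedZ aI).
set w := fval a _ _; move=> Ew.
rewrite mulrA -ler_pdivlMl ?mulr_gt0//; apply: le_trans Ew _.
by rewrite mulrA invfM.
Qed.

(** Scaling the negative part leaves the positive part alone: for l > 0, z = u^+ - l u^- has z^+ =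
    u^+, so E (u^+) <= E (z) = E (u^+) - 2 l P + l^2 Q, that is 2 P <= l Q, and l can be taken
    small. *)
Lemma dirichlet_posneg u : fdom a u -> C0 u ->
  [/\ fdom a u^\+, fdom a u^\- & fval a u^\+ u^\- <= 0].
Proof.
move=> Du Cu; have [Dp Ep] := dirichlet_funrpos Du Cu.
have DN : fdom a (\- u).
  rewrite (_ : \- u = (fun x => -1 * u x)); first exact: (si_closedZ aI).
  by apply/funext => x /=; rewrite mulN1r.
have CN : C0 (\- u).
  apply: C0_sub (Cu) _ _; last by move=> x /= ->; rewrite oppr0.
  by move=> x; apply: cvgN; exact: Cu.1.
have [Dn En] := dirichlet_funrpos DN CN; rewrite funrposN in Dn En.
split=> //; have Cp := C0_funrpos Cu; have Cn := C0_funrneg Cu.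
set P := fval a u^\+ u^\-; set Q := fval a u^\- u^\-.
have Q0 : 0 <= Q by exact: (si_ge0 aI).
have key (l : R) : 0 < l -> 2 * P <= l * Q.
  move=> l0; pose z := u^\+ \- (fun x => l * u^\- x).
  have Dln : fdom a (fun x => l * u^\- x) by exact: (si_closedZ aI).
  have Dz : fdom a z by exact: (si_closedB aI).
  have zp : z^\+ = u^\+.
    apply/funext => x; rewrite {1}/funrpos /z /=.
    have [ux|ux] := leP (u x) 0.
      rewrite {1 2}/funrpos (max_idPr ux) sub0r; apply/max_idPr.
      by rewrite oppr_le0 mulr_ge0// ltW.
    rewrite /funrneg [X in l * X](max_idPr _) ?mulr0 ?subr0; last by rewrite oppr_le0 ltW.
    by apply/max_idPl; rewrite funrpos_ge0.
  have Cz : C0 z.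
    rewrite /z (_ : _ \- _ = (fun x => (- l) * u^\- x + u^\+ x)); first exact: C0_lin.
    by apply/funext => x /=; rewrite mulNr addrC.
  have [_] := dirichlet_funrpos Dz Cz; rewrite zp /energy {2}/z.
  rewrite (si_subl aI)// /z !(si_subr aI)// !(si_scalel aI)// !(si_scaler aI)//.
  rewrite (si_sym aI Dn Dp) -/P -/Q.
  move=> H; rewrite -(ler_pM2l l0); have -> : l * (2 * P) = 2 * (l * P) by ring.
  lra.
have [P0|P0] := leP P 0; first by [].
(* With this l the bound reads 2 P (Q + 1) <= P Q, against P > 0. *)
have := key (P / (Q + 1)); rewrite divr_gt0//; last by lra.
move=> /(_ isT); rewrite mulrAC ler_pdivlMr; last by lra.
have : 0 <= P * Q by rewrite mulr_ge0// ltW.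
lra.
Qed.

Variable mu : {measure set E -> \bar R}.
Hypothesis mu_radon : radon mu.
Local Notation core := (schrodinger_core a mu).
Hypothesis core_psd : positive_semidefinite core.

Lemma schrodinger_core_val u v : fval core u v = fval a u v - inner mu u v.
Proof. by []. Qed.

Lemma schrodinger_core_semi_inner : semi_inner (fdom core) (fval core).
Proof.
have MI := L2_semi_inner mu.
split.
- by split; [exact: (si_0 aI)|exact: C0_0].
- by move=> c u v [Du Cu] [Dv Cv]; split; [exact: (si_lin aI)|exact: C0_lin].
- move=> c u v h [Du Cu] [Dv Cv] [Dh Ch]; rewrite !schrodinger_core_val.
  rewrite (si_val aI)// (si_val MI); try exact: C0_L2.
  by ring.
- move=> u v [Du Cu] [Dv Cv]; rewrite !schrodinger_core_val (si_sym aI)//.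
  by rewrite (si_sym MI); [|exact: C0_L2|exact: C0_L2].
- by move=> u Du; exact: core_psd.
Qed.

(** u^+ u^- = 0 pointwise, so [mu] contributes nothing to the mixed term. *)
Lemma schrodinger_core_posneg u : fdom core u ->
  [/\ fdom core u^\+, fdom core u^\- & fval core u^\+ u^\- <= 0].
Proof.
move=> [Du Cu]; have [Dp Dn pn] := dirichlet_posneg Du Cu.
split; [by split => //; exact: C0_funrpos|by split => //; exact: C0_funrneg|].
rewrite schrodinger_core_val (_ : inner mu _ _ = 0) ?subr0//.
rewrite /inner; under eq_Rintegral => x _.
  have -> : u^\+ x * u^\- x = 0.
    rewrite /funrpos /funrneg !maxEle.
    by repeat case: ifPn; rewrite -?ltNge => *; rewrite ?mulr0 ?mul0r//; lra.
  over.
by rewrite /Rintegral integral0.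
Qed.

End core.

(** * The potential of g *)

Section potential_theory.
Context {R : realType} {d : measure_display} {E : borelMetricType R d}.
Variable m : {measure set E -> \bar R}.
Local Notation snorm := (seminorm (inner m)).
Local Notation LI := (L2_semi_inner m).

(** g^2 <= M |g| a.e. *)
Lemma Lfun1_bounded_L2 (g : E -> R) (M : R) : g \in Lfun m 1 ->
  {ae m, forall x, `|g x| <= M} -> L2 m g.
Proof.
move=> g1 gM; have mg : measurable_fun setT g.
  by move: g1; rewrite inE => /andP[/[!inE]].
(* A negative [M] is compatible with the bound when m = 0. *)
have [M0|M0] := leP 0 M; last first.
  have g0 : {ae m, forall x, (setT x -> ((g x) ^+ 2)%:E = cst 0%E x)}.
    apply: filterS gM => x gx; have := normr_ge0 (g x).
    by rewrite leNgt (le_lt_trans gx M0).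
  apply: L2I => //; rewrite (ae_eq_integral (cst 0%E))//= ?integral0//.
  by apply/measurable_EFinP; exact: measurable_funX.
have ig := (Lfun1_integrable m g).1 g1.
apply: L2I => //; apply: (@le_lt_trans _ _ (\int[m]_x (M%:E * `|(g x)%:E|))%E).
  apply: ae_ge0_le_integral => //.
  - by move=> x _; rewrite lee_fin sqr_ge0.
  - by apply/measurable_EFinP; exact: measurable_funX.
  - by move=> x _; rewrite mule_ge0.
  - by apply: measurable_funeM; apply: measurableT_comp => //; exact/measurable_EFinP.
  - apply: filterS gM => x gx _; rewrite -EFinM lee_fin.
    by rewrite -(real_normK (num_real (g x))) expr2 ler_wpM2r.
rewrite ge0_integralZl//; last first.
  by apply: measurableT_comp => //; exact/measurable_EFinP.
by rewrite lte_mul_pinfty//; have /integrableP[] := ig.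
Qed.

Lemma inner_ge0 (f g : E -> R) : L2 m f -> L2 m g ->
  {ae m, forall x, 0 <= f x} -> {ae m, forall x, 0 <= g x} -> 0 <= inner m f g.
Proof.
have Labs (h : E -> R) : L2 m h -> L2 m (fun x => `|h x|).
  move=> Lh; apply: (L2_dom _ Lh); last by move=> x; rewrite normr_id.
  by apply: measurableT_comp => //; exact: L2_meas Lh.
have ae_abs (h : E -> R) : {ae m, forall x, 0 <= h x} -> h = (fun x => `|h x|) %[ae m].
  by apply: filterS => x hx _; rewrite ger0_norm.
move=> Lf Lg f0 g0; have [Lf' Lg'] := (Labs _ Lf, Labs _ Lg).
rewrite (inner_ae Lf Lf' Lg (ae_abs _ f0)) (si_sym LI)//.
rewrite (inner_ae Lg Lg' Lf' (ae_abs _ g0)).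
by apply: Rintegral_ge0 => x _; rewrite mulr_ge0.
Qed.

(** * The time integrals of the semigroup: positivity, monotonicity, energy *)

Variables (b : L2form E R) (T : R -> (E -> R) -> (E -> R)).
Hypothesis Tb : semigroup_of m b T.
Local Notation TS := Tb.1.
Variable g : E -> R.
Hypothesis Lg : L2 m g.
Hypothesis T_pos : forall (t : R) f, 0 <= t -> L2 m f -> {ae m, forall x, 0 <= f x} ->
  {ae m, forall x, 0 <= T t f x}.
Hypothesis g_ge0 : {ae m, forall x, 0 <= g x}.
Variable S : nat -> E -> R.
Hypothesis IS : forall N, L2_integral m (fun t => T t g) 0 N%:R (S N).

Let Tg0 t (t0 : 0 <= t) : {ae m, forall x, 0 <= T t g x}.
Proof. exact: T_pos. Qed.

Let LS N : L2 m (S N). Proof. by have [] := IS N. Qed.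
Let LT N : L2 m (T N%:R g). Proof. by apply: (semigroup_L2 TS). Qed.

(** The mesh 1 / (n + 1) serves every N, with N (n + 1) steps: the sums for S_M, S_N and S_(M+N)
    share a grid that contains the integers. *)
Lemma integral_near N (e : R) : 0 < e -> exists k, forall n, (k <= n)%N ->
  snorm (step_sum T (n.+1%:R^-1) (N * n.+1) g \- S N) < e.
Proof.
move=> e0; have [delta d0 Hd] := L2_integral_step_sum TS Lg (ler0n _ N) (IS N) e0.
have [k Hk] := archi_div 1 d0; exists k => n kn; apply: Hd.
- by rewrite invr_ge0.
- by have := Hk n kn; rewrite div1r.
- by rewrite natrM mulfK.
Qed.

Lemma integral_ge0 N : {ae m, forall x, 0 <= S N x}.
Proof.
have LSn : L2 m (S N)^\- by exact: L2_funrneg.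
suff H : snorm (S N)^\- = 0.
  have := snorm_eq0 LSn H; apply: filterS => x /(_ I) /=.
  rewrite /funrneg maxEle; case: ifPn => [|_ /eqP]; first by rewrite oppr_le0.
  by rewrite oppr_eq0 => /eqP ->.
apply/eqP; rewrite eq_le seminorm_ge0 andbT; apply/ler_addgt0Pr => e e0; rewrite add0r.
have [n /(_ n (leqnn n)) Hn] := integral_near N e0.
have h0 : 0 <= (n.+1%:R^-1 : R) by rewrite invr_ge0.
have LU := L2_step_sum TS (N * n.+1) h0 Lg.
apply: le_trans (snorm_funrneg_le (LS N) LU) _.
rewrite (snorm_ae_eq (f' := cst 0)).
- by rewrite {1}/seminorm (si_0l LI (L2_0 m)) sqrtr0 add0r (seminorm_subC LI)// ltW.
- exact: L2_funrneg.
- exact: L2_0.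
have : {ae m, forall x, forall i : nat, 0 <= T (i%:R * n.+1%:R^-1) g x}.
  by apply: ae_foralln => i; apply: Tg0; rewrite mulr_ge0.
apply: filterS => x Tx _; rewrite /funrneg; apply/max_idPr; rewrite oppr_le0.
by apply: sumr_ge0 => i _; rewrite mulr_ge0.
Qed.

(** Limit of [semigroup_step_sum]: on the common grid, the time M is a whole number of steps. Each
    of the three integrals involved costs e / 3. *)
Lemma semigroup_integral M N : T M%:R (S N) = S (M + N)%N \- S M %[ae m].
Proof.
have LTS : L2 m (T M%:R (S N)) by apply: (semigroup_L2 TS).
have LSS : L2 m (S (M + N)%N \- S M) by exact: (si_closedB LI).
suff H : snorm (T M%:R (S N) \- (S (M + N)%N \- S M)) = 0.
  have := snorm_eq0 (si_closedB LI LTS LSS) H; apply: filterS => x /[apply] /= /eqP.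
  by rewrite subr_eq0 => /eqP.
apply/eqP; rewrite eq_le seminorm_ge0 andbT; apply/ler_addgt0Pr => e e0; rewrite add0r.
have e30 : 0 < e / 3 by rewrite divr_gt0.
have [k1 H1] := integral_near N e30.
have [k2 H2] := integral_near M e30.
have [k3 H3] := integral_near (M + N) e30.
pose n := maxn k1 (maxn k2 k3).
have : (n <= n)%N by []; rewrite {1}/n !geq_max => /and3P[/H1{}H1 /H2{}H2 /H3{}H3].
have h0 : 0 <= (n.+1%:R^-1 : R) by rewrite invr_ge0.
have LU k := L2_step_sum TS k h0 Lg.
set U := step_sum T _ in LU H1 H2 H3.
have LTU : L2 m (T M%:R (U (N * n.+1)%N g)) by apply: (semigroup_L2 TS).
have LUB : L2 m (U ((M + N) * n.+1)%N g \- U (M * n.+1)%N g) by exact: (si_closedB LI).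
apply: le_trans (seminorm_tri LI LTS LTU LSS) _.
have -> : e = e / 3 + (e / 3 + e / 3) by field.
apply: lerD.
  apply: le_trans (semigroup_dist TS (ler0n _ M) (LS N) (LU _)) _.
  by rewrite (seminorm_subC LI)// ltW.
rewrite (snorm_ae_eq (f' := (U ((M + N) * n.+1)%N g \- S (M + N)%N) \-
    (U (M * n.+1)%N g \- S M))).
- have D1 := si_closedB LI (LU ((M + N) * n.+1)%N) (LS (M + N)%N).
  have D2 := si_closedB LI (LU (M * n.+1)%N) (LS M).
  have L0 := L2_0 m.
  rewrite (_ : _ \- _ = (U ((M + N) * n.+1)%N g \- S (M + N)%N) \+ (S M \- U (M * n.+1)%N g)).
    apply: le_trans (seminormD LI _ _) _ => //; first exact: (si_closedB LI).
    by apply: lerD; rewrite ltW// (seminorm_subC LI).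
  by apply/funext => x /=; ring.
- exact: (si_closedB LI).
- by apply: (si_closedB LI); exact: (si_closedB LI).
- have := semigroup_step_sum TS (M * n.+1) (N * n.+1) h0 Lg.
  rewrite -mulnDl natrM mulfK// -/U => HU.
  by apply: filterS HU => x /(_ I) /= -> _; ring.
Qed.

Let p N := inner m (S N) g.

(** T_M is moved onto S_N by symmetry. All energies below reduce to values of [p] through this
    identity. *)
Lemma inner_T_integral M N : inner m (T M%:R g) (S N) = p (M + N) - p M.
Proof.
have LTS : L2 m (T M%:R (S N)) by apply: (semigroup_L2 TS).
have LSS : L2 m (S (M + N)%N \- S M) by exact: (si_closedB LI).
rewrite (sg_sym TS)// (si_sym LI)// (inner_ae LTS LSS Lg (semigroup_integral M N)).
by rewrite (si_subl LI).
Qed.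

(** p_N - p_M = (T_M g, S_(N-M)), an inner product of nonnegative functions. *)
Lemma inner_integral_homo M N : (M <= N)%N -> p M <= p N.
Proof.
move=> MN; rewrite -subr_ge0 -[in p N](subnKC MN) -inner_T_integral.
by apply: inner_ge0 => //; [exact: Tg0|exact: integral_ge0].
Qed.

(** [L2_integral_generator] is for intervals of positive length, hence the index [N.+1] here and in
    the energies. *)
Let gS N : sg_generator m T (S N.+1) (T N.+1%:R g \- g).
Proof. by apply: (L2_integral_generator TS _ Lg (IS N.+1)). Qed.

Let LTg N : L2 m (T N%:R g \- g). Proof. exact: (si_closedB LI). Qed.

Let S_gen N : fdom b (S N.+1) /\ forall v, fdom b v ->
  fval b (S N.+1) v = - inner m (T N.+1%:R g \- g) v.
Proof. exact/(Tb.2 _ _ (LS _) (LTg _)).1/gS. Qed.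

Lemma energy_integral N : energy b (S N.+1) = p N.+1 - (p (N.+1 + N.+1) - p N.+1).
Proof.
have [D H] := S_gen N; rewrite /energy H// (si_subl LI)// inner_T_integral.
rewrite (si_sym LI Lg)// -/(p _); ring.
Qed.

(** The difference is itself in the domain of the generator, which yields both its membership in the
    form domain and its energy. *)
Lemma energy_integralB N M : fdom b (S N.+1 \- S M.+1) /\
  energy b (S N.+1 \- S M.+1) =
  2 * p (N.+1 + M.+1) - p (M.+1 + M.+1) - p (N.+1 + N.+1).
Proof.
have LB : L2 m (S N.+1 \- S M.+1) by exact: (si_closedB LI).
have LTB : L2 m ((T N.+1%:R g \- g) \- (T M.+1%:R g \- g)) by exact: (si_closedB LI).
have G := sg_generatorB TS (LS _) (LTg N.+1) (LS _) (LTg M.+1) (gS N) (gS M).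
have [D H] := (Tb.2 _ _ LB LTB).1 G; split => //.
rewrite /energy H// (si_subl LI)// !(si_subr LI)// !(si_subl LI)// !inner_T_integral.
by rewrite (addnC M.+1 N.+1); ring.
Qed.

(** [p] converges, being monotone and bounded. In the energy of a difference the coefficients 2, -1,
    -1 sum to 0 and their absolute values to 4, whence e / 4. *)
Lemma form_cauchy_integral (B : R) : (forall N, p N <= B) ->
  form_cauchy b (fun n => S n.+1).
Proof.
move=> pB; split; first by move=> n; have [] := S_gen n.
have cp : cvgn p.
  apply: nondecreasing_is_cvgn; first by move=> M N MN; exact: inner_integral_homo.
  by exists B => _ [N _ <-].
move=> e e0; have e40 : 0 < e / 4 by rewrite divr_gt0.
have /cvgrPdist_lt/(_ _ e40) [K _ HK] := cp.
exists K => n k Kn Kk; rewrite (energy_integralB n k).2.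
have K1 i j : (K <= i)%N -> `|limn p - p (i.+1 + j)| < e / 4.
  by move=> Ki; apply: HK => /=; rewrite (leq_trans Ki)// addSnnS leq_addr.
have := K1 n k.+1 Kn; have := K1 k k.+1 Kk; have := K1 n n.+1 Kn.
rewrite !ltr_norml => /andP[? ?] /andP[? ?] /andP[? ?]; lra.
Qed.

(** * Consequences of subcriticality *)

Hypothesis g_sub : subcritical_fun m b g.

Let mS N : measurable_fun setT (EFin \o S N).
Proof. by apply/measurable_EFinP; exact: L2_meas (LS N). Qed.

(** S_(N+1) lies in the domain of b, so the constant sequence approximates it in the extended space,
    with the same energy; that this sequence is Cauchy is the case M = N of [energy_integralB]. *)
Lemma subcritical_integral N :
  (\int[m]_x (`|(S N.+1 x)%:E| * (g x)%:E) <= (Num.sqrt (energy b (S N.+1)))%:E)%E.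
Proof.
have [_ H] := g_sub.
have ap : ext_approx m b (EFin \o S N.+1) (fun=> S N.+1).
  split; last by apply: nearW => x; exact: cvg_cst.
  split; first by move=> n; have [] := S_gen N.
  move=> e e0; exists 0%N => n k _ _; rewrite (energy_integralB N N).2.
  by rewrite (_ : _ - _ - _ = 0)//; ring.
apply: (H (EFin \o S N.+1)).
  split; [by exists (EFin \o S N.+1) => //; exact: ae_eq_refl|
    by apply: nearW => x; rewrite /= ltry|].
  by exists (fun=> S N.+1).
by exists (fun=> S N.+1) => //; exact: cvg_cst.
Qed.

Let g0 : {ae m, forall x, 0 < g x}. Proof. by have [[]] := g_sub. Qed.

Lemma inner_integral_le N : ((p N)%:E <= \int[m]_x (`|(S N x)%:E| * (g x)%:E))%E.
Proof.
have iSg := L2_mul_integrable (LS N) Lg.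
rewrite /p /inner /Rintegral fineK; last exact: integrable_fin_num.
rewrite le_eqVlt; apply/orP; left; apply/eqP; apply: ae_eq_integral => //.
- exact: (measurable_int m iSg).
- apply: emeasurable_funM; first by apply: measurableT_comp => //; exact: mS.
  by apply/measurable_EFinP; exact: L2_meas Lg.
- by apply: filterS (integral_ge0 N) => x Sx _ /=; rewrite EFinM ger0_norm.
Qed.

Lemma inner_integral_le1 N : p N <= 1.
Proof.
(* The energy estimate is for positive indices; monotonicity brings in p_0. *)
apply: le_trans (inner_integral_homo (leqnSn N)) _.
have := le_trans (inner_integral_le N.+1) (subcritical_integral N); rewrite lee_fin.
have pp : p N.+1 <= p (N.+1 + N.+1) by apply: inner_integral_homo; exact: leq_addr.
have p0 : 0 <= p N.+1.
  by apply: inner_ge0 => //; exact: integral_ge0.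
have eN : energy b (S N.+1) <= p N.+1 by rewrite energy_integral; lra.
move=> H; have := le_trans H (ler_wsqrtr eN).
move: (p N.+1) p0 => r r0 rs; have [//|r1] := leP r 1.
have : r ^+ 2 <= (Num.sqrt r) ^+ 2 by rewrite lerXn2r ?nnegrE ?sqrtr_ge0.
by rewrite sqr_sqrtr// expr2 -[leRHS]mul1r ler_pM2r//; lra.
Qed.

Lemma integral_le1 N : (\int[m]_x (`|(S N.+1 x)%:E| * (g x)%:E) <= 1)%E.
Proof.
apply: le_trans (subcritical_integral N) _; rewrite lee_fin.
rewrite -[leRHS]sqrtr1; apply: ler_wsqrtr; rewrite energy_integral.
have := inner_integral_le1 N.+1; have : p N.+1 <= p (N.+1 + N.+1).
  by apply: inner_integral_homo; exact: leq_addr.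
lra.
Qed.

Lemma ext_dom_potential (G : E -> \bar R) :
  {ae m, forall x, (S n x)%:E @[n --> \oo] --> G x} -> ext_dom m b G.
Proof.
(* [G] is prescribed only a.e. and may fail to be Borel; the upper limit is a Borel
   representative. *)
move=> SG; pose G' x := limn_esup (fun n => (S n x)%:E).
have mG' : measurable_fun setT G' by exact: measurable_fun_limn_esup.
have GG' : G = G' %[ae m].
  by apply: filterS SG => x /cvg_limn_einf_sup[_ e] _; rewrite /G' e.
have SG' : {ae m, forall x, (S n.+1 x)%:E @[n --> \oo] --> G x}.
  by apply: filterS SG => x; rewrite -(cvg_shiftS (fun n => (S n x)%:E)).
split; first by exists G'.
  have mg : measurable_fun setT (EFin \o g).
    by apply/measurable_EFinP; exact: L2_meas Lg.
  (* |g| stands for g, to which it is equal a.e., since [fatou_le] asks for integrands nonnegative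
     everywhere. *)
  have mGg : measurable_fun setT (fun x => `|G' x| * `|(g x)%:E|)%E.
    by apply: emeasurable_funM; apply: measurableT_comp.
  have Gg1 : (\int[m]_x (`|G' x| * `|(g x)%:E|) <= 1)%E.
    apply: (@fatou_le _ _ _ m (fun n x => `|(S n.+1 x)%:E| * `|(g x)%:E|)%E) => //.
    - by move=> n; apply: emeasurable_funM; apply: measurableT_comp => //; exact: mS.
    - by apply: filterS2 SG' GG' => x Sx /(_ I) <-; apply: cvgeZr => //; exact: cvg_abse.
    - move=> n; apply: le_trans (integral_le1 n); rewrite le_eqVlt; apply/orP; left.
      apply/eqP; apply: ae_eq_integral => //.
      + by apply: emeasurable_funM; apply: measurableT_comp => //; exact: mS.
      + by apply: emeasurable_funM => //; apply: measurableT_comp => //; exact: mS.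
      + by apply: filterS g0 => x gx _; rewrite [`|(g x)%:E|%E]gee0_abs// lee_fin ltW.
  have iGg : m.-integrable setT (fun x => `|G' x| * `|(g x)%:E|)%E.
    apply/integrableP; split=> //; apply: le_lt_trans (ltry 1).
    by under eq_integral do rewrite abseM !abse_id.
  (* Where g > 0, an infinite value of [G'] would make the product infinite, against its
     integrability. *)
  apply: filterS3 (integrable_ae measurableT iGg) g0 GG' => x /(_ I) + gx /(_ I) ->.
  rewrite ltey; apply: contraTneq => ->.
  by rewrite mulyr gtr0_sg ?mul1e// normr_gt0 gt_eqF.
exists (fun n => S n.+1); split => //.
exact: form_cauchy_integral inner_integral_le1.
Qed.

(** S_(N+1) - S_N = T_N S_1 a.e. This provides the a.e. limit required by [potential]. *)
Lemma integral_homo : {ae m, forall x, forall N, S N x <= S N.+1 x}.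
Proof.
apply: ae_foralln => N.
have := T_pos (ler0n R N) (LS 1) (integral_ge0 1); have := semigroup_integral N 1.
by apply: filterS2 => x /(_ I) -> /=; rewrite subr_ge0 addn1.
Qed.

End potential_theory.

(** [potential] is a relation that fixes G only a.e.; existence is stated apart, so that membership,
    claimed for every such G, is not vacuous. *)
Theorem lemma2p3 (R : realType) (d : measure_display) (E : borelMetricType R d)
  (E_lc : locally_compact [set: E]) (E_sep : separable E)
  (m : {measure set E -> \bar R}) (m_radon : radon m)
  (m_supp : full_support m)
  (a : L2form E R) (a_df : dirichlet_form m a) (a_reg : regular_form m a)
  (a_irr : irreducible m a) (a_trans : transient m a)
  (mu : {measure set E -> \bar R}) (mu_radon : radon mu)
  (mu_smooth : smooth m a mu)
  (amu_psd : positive_semidefinite (schrodinger_core a mu))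
  (amu_closable : closable m (schrodinger_core a mu))
  (amu_sub : subcritical m (schrodinger m a mu))
  (T : R -> (E -> R) -> (E -> R))
  (T_sg : semigroup_of m (schrodinger m a mu) T)
  (g : E -> R) (g_sub : subcritical_fun m (schrodinger m a mu) g) :
  (exists G : E -> \bar R, potential m T g G) /\
  (forall G : E -> \bar R, potential m T g G ->
     ext_dom m (schrodinger m a mu) G).
Proof.
have [[g1 [M gM] g_gt0] _] := g_sub.
have Lg := Lfun1_bounded_L2 g1 gM.
have g_ge0 : {ae m, forall x, 0 <= g x} by apply: filterS g_gt0 => x /ltW.
have core_si := schrodinger_core_semi_inner a_df mu_radon amu_psd.
have coreL2 : fdom (schrodinger_core a mu) `<=` L2 m.
  by move=> u [Du _]; exact: df_L2 a_df _ Du.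
have T_pos (t : R) f : 0 <= t -> L2 m f -> {ae m, forall x, 0 <= f x} ->
    {ae m, forall x, 0 <= T t f x}.
  (* If A u = v, then b (u, w) = - (v, w) for w in the closure, which is what dissipativity is
     deduced from. *)
  apply: (semigroup_ge0 T_sg.1) => u v Lu Lv /(T_sg.2 _ _ Lu Lv)[Du Hu].
  exact: (closure_dissipative core_si coreL2 amu_closable
    (schrodinger_core_posneg a_df (mu := mu)) Lv Du Hu).
split; last first.
  by move=> G [S IS SG]; exact: (ext_dom_potential T_sg Lg T_pos g_ge0 IS g_sub SG).
have [S IS] := choice (fun N : nat => semigroup_integral_exists T_sg.1 (ler0n R N) Lg).
(* The supremum is defined at every point and is the limit wherever the sequence is
   nondecreasing. *)
exists (fun x => ereal_sup (range (fun N => (S N x)%:E))), S => //.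
apply: filterS (integral_homo T_sg Lg T_pos g_ge0 IS) => x Sx.
apply: ereal_nondecreasing_cvgn; apply/nondecreasing_seqP => n.
by rewrite lee_fin.
Qed.
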